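(* Let $J\subseteq\mathbb Z^{\ge0}$. Let $\boldsymbol T_0:=\{0\}$; for $n\ge0$, if $n\in J$ let $\boldsymbol T_{n+1}:=\boldsymbol T_n\cup(\boldsymbol T_n\pm2\times2^n)$, where the sign is chosen i.i.d. over $n$, each sign with probability $1/2$, and if $n\notin J$ let $\boldsymbol T_{n+1}:=\boldsymbol T_n$. Let $\Psi:=\bigcup_n\boldsymbol T_n\subseteq\mathbb Z$, with origin $\boldsymbol o=0$. Then, almost surely, $$\mathrm{udim}_H(\Psi)=\overline{\mathrm{udim}}_M(\Psi)=\overline{\mathrm{growth}}(\#N_n(\boldsymbol o))=\overline d(J),$$ $$\underline{\mathrm{udim}}_M(\Psi)=\underline{\mathrm{growth}}(\#N_n(\boldsymbol o))=\underline d(J).$$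
   Context: Densities and growth. With $J_n:=\#(J\cap\{0,\dots,n\})$, $\overline d(J):=\limsup_n\frac1nJ_n$ and $\underline d(J):=\liminf_n\frac1nJ_n$. For a nonnegative function $f$, $\overline{\mathrm{growth}}(f)=\limsup_{n\to\infty}\frac{\log f(n)}{\log n}$, $\underline{\mathrm{growth}}(f)=\liminf_{n\to\infty}\frac{\log f(n)}{\log n}$. $\Psi$ has the Euclidean metric; it is a point-stationary point process, i.e. a random locally finite subset of $\mathbb R$ with $0\in\Psi$ such that $\mathbb E[\sum_{x\in\Psi}g(\Psi,0,x)]=\mathbb E[\sum_{x\in\Psi}g(\Psi,x,0)]$ for all measurable $g(\varphi,x,y)\ge0$ invariant under joint translations. Equivariant processes. An equivariant process with values in a complete separable metric space $\Xi$ on $\Psi$ assigns to (almost) every realization $\varphi$ a random marking $\boldsymbol Z_\varphi\in\Xi^{\varphi\times\varphi}$ (extra randomness allowed; the mark of a point $x$ is that of $(x,x)$), depending measurably on $\varphi$, such that for every translation $\rho$, $\boldsymbol Z_\varphi\circ\rho^{-1}$ has the same distribution as $\boldsymbol Z_{\rho(\varphi)}$. An equivariant subset is the set of points with mark 1 in a $\{0,1\}$-valued equivariant process; its intensity is $\mathbb P[0\in\boldsymbol S_\Psi]$. Dimensions. $N_r(v)$ is the closed ball in $\Psi$ of radius $r\ge1$ and $N_0(v):=\emptyset$. An equivariant $r$-covering is an equivariant subset $\boldsymbol R$ such that the balls $N_r(v)$, $v\in\boldsymbol R_\Psi$, cover $\Psi$ a.s.; $\lambda_r$ is the infimum of their intensities;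 $\overline{\mathrm{udim}}_M(\Psi):=\limsup_{r\to\infty}\frac{-\log\lambda_r}{\log r}$, $\underline{\mathrm{udim}}_M(\Psi):=\liminf_{r\to\infty}\frac{-\log\lambda_r}{\log r}$. An equivariant covering is an equivariant process $\boldsymbol R$ with values in $\{0\}\cup[1,\infty)$ on points such that the balls $N_{\boldsymbol R(v)}(v)$ cover $\Psi$ a.s.; $\mathcal H^\alpha_1(\Psi):=\inf_{\boldsymbol R}\mathbb E[\boldsymbol R(0)^\alpha]$ over all of them ($0^0:=0$), and $\mathrm{udim}_H(\Psi):=\sup\{\alpha\ge0:\mathcal H^\alpha_1(\Psi)=0\}$, $\sup\emptyset:=0$. *)

(* Defs.v *)
From HB Require Import structures.
From mathcomp Require Import all_boot all_order all_algebra finmap.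
From mathcomp Require Import all_classical all_reals all_analysis measurable_realfun.
From mathcomp Require Import zify.

Set Implicit Arguments.
Unset Strict Implicit.
Unset Printing Implicit Defensive.

Import Order.TTheory GRing.Theory Num.Theory.
Import numFieldNormedType.Exports.

Local Open Scope classical_set_scope.
Local Open Scope card_scope.
Local Open Scope ring_scope.

Section growth.
Context {R : realType}.
Local Open Scope ereal_scope.

(* J_n counts 0, ..., n, so its range is `I_n.+1.  The value at n = 0 does not
   matter. *)
Definition density_seq (J : set nat) (n : nat) : \bar R :=
  counting (R := R) (J `&` `I_n.+1) * (n%:R^-1)%:E.

Definition upper_density (J : set nat) : \bar R := limn_esup (density_seq J).
Definition lower_density (J : set nat) : \bar R := limn_einf (density_seq J).

(* [lne 0 = -oo]; the values at n = 0, 1 do not matter. *)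
Definition growth_seq (f : nat -> \bar R) (n : nat) : \bar R :=
  lne (f n) * ((ln n%:R)^-1)%:E.

Definition upper_growth (f : nat -> \bar R) : \bar R :=
  limn_esup (growth_seq f).
Definition lower_growth (f : nat -> \bar R) : \bar R :=
  limn_einf (growth_seq f).

End growth.

Record lfset (R : realType) := LFSet {
  pts :> set R ;
  lfset_finite : forall a b : R, finite_set (pts `&` `[a, b]) }.

HB.instance Definition _ (R : realType) := gen_eqMixin (lfset R).
HB.instance Definition _ (R : realType) := gen_choiceMixin (lfset R).

Section lfset.
Context {R : realType}.

Let lfset0_finite (a b : R) : finite_set (set0 `&` `[a, b]).
Proof. by rewrite set0I. Qed.

HB.instance Definition _ := isPointed.Build (lfset R) (LFSet lfset0_finite).

(* The usual sigma-algebra of point processes: it makes phi |-> #(phi n B)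
   measurable for every Borel set B. *)
Definition count_events : set (set (lfset R)) :=
  [set E | exists B : set R, exists k : nat, measurable B /\
     E = [set phi : lfset R | phi `&` B #= `I_k]].

HB.instance Definition _ :=
  Measurable.copy (lfset R) (g_sigma_algebraType count_events).

Let shift_finite (t : R) (phi : lfset R) (a b : R) :
  finite_set ([set x | pts phi (x - t)] `&` `[a, b]).
Proof.
apply: (@sub_finite_set _ _ ((fun x => x + t) @` (phi `&` `[a - t, b - t]))).
  move=> x [/= px]; rewrite in_itv/= => /andP[ax xb].
  exists (x - t); last by rewrite subrK.
  by split => //; rewrite /= in_itv/= !lerD2r ax.
by apply: finite_image; exact: lfset_finite.
Qed.

(* phi + t *)
Definition lfshift (t : R) (phi : lfset R) : lfset R :=
  LFSet (shift_finite t phi).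

(* N_r(v), with N_0(v) empty; only r = 0 and r >= 1 are ever used. *)
Definition nball (phi : lfset R) (r v : R) : set R :=
  if r == 0 then set0 else [set x | pts phi x /\ `|x - v| <= r].

End lfset.

(* An element of Xi^(phi x phi). *)
Definition marking {R : realType} (Xi : Type) (phi : lfset R) : Type :=
  set_type phi -> set_type phi -> Xi.

Section marking.
Context {R : realType} {d : measure_display} {Xi : measurableType d}.

HB.instance Definition _ (phi : lfset R) := Pointed.copy (marking Xi phi)
  (set_type phi -> set_type phi -> Xi).

Definition cylinder_events (phi : lfset R) : set (set (marking Xi phi)) :=
  [set E | exists x y : set_type phi, exists C : set Xi, measurable C /\
     E = [set m : marking Xi phi | C (m x y)]].

HB.instance Definition _ (phi : lfset R) := Measurable.copy (marking Xi phi)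
  (g_sigma_algebraType (@cylinder_events phi)).

Definition marked : Type := {phi : lfset R & marking Xi phi}.

(* The sigma-algebra on the space of pairs (phi, m): it makes the number of
   (x, y) in (B1 n phi) x (B2 n phi) with mark in C measurable. *)
Definition marked_count_events : set (set marked) :=
  [set E | exists B1 B2 : set R, exists C : set Xi, exists k : nat,
     [/\ measurable B1, measurable B2, measurable C &
      E = [set q : marked | let: existT phi m := q in
             [set p : set_type phi * set_type phi |
                [/\ B1 (val p.1), B2 (val p.2) & C (m p.1 p.2)]] #= `I_k]]].

Definition marked_measurable : set (set marked) :=
  <<s marked_count_events >>.

(* The mark of the point x, i.e. that of the pair (x, x); None if x is not in
   phi. *)
Definition point_mark (phi : lfset R) (m : marking Xi phi) (x : R) :
    option Xi :=
  if pselect (pts phi x) is left px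
  then Some (m (exist _ x (mem_set px)) (exist _ x (mem_set px))) else None.

Definition unshift (t : R) (phi : lfset R) (x : set_type (lfshift t phi)) :
    set_type phi :=
  exist _ (val x - t) (mem_set (set_mem (valP x))).

(* m o rho^-1, where rho is the translation by t *)
Definition shift_marking (t : R) (phi : lfset R) (m : marking Xi phi) :
    marking Xi (lfshift t phi) :=
  fun x y => m (unshift x) (unshift y).

End marking.

Arguments shift_marking {R d Xi} t {phi} m x y.

(* The random marking Z_phi (with its extra randomness) is given through its
   law.  The domain on which the process is specified has full measure and is
   translation-invariant; the values of [eproc_law] outside it are irrelevant.
   Xi is meant to carry the Borel sigma-algebra of a complete separable metric
   space. *)
Record eproc {R : realType} {d d' : measure_display}
    {Omega : measurableType d} (P : probability Omega R)
    (Psi : Omega -> lfset R) (Xi : measurableType d') := EProc {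
  eproc_dom : set (lfset R) ;
  eproc_law :> forall phi : lfset R, probability (marking Xi phi) R ;
  eproc_dom_ae : {ae P, forall w, eproc_dom (Psi w)} ;
  eproc_dom_shift : forall (t : R) (phi : lfset R),
    eproc_dom phi -> eproc_dom (lfshift t phi) ;
  eproc_measurable : forall A : set (@marked R d' Xi),
    marked_measurable A ->
    measurable_fun [set: lfset R]
      (fun phi => eproc_law phi [set m | A (existT _ phi m)] : \bar R) ;
  eproc_equivariant : forall (t : R) (phi : lfset R), eproc_dom phi ->
    forall C : set (marking Xi (lfshift t phi)), measurable C ->
    eproc_law phi (shift_marking t @^-1` C) = eproc_law (lfshift t phi) C }.

(* The space {0} U [1, +oo[, with the trace of the Borel sigma-algebra. *)
Definition radius (R : realType) : Type :=
  {r : R | (r == 0) || (1 <= r)}.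

HB.instance Definition _ (R : realType) := Choice.on (radius R).
HB.instance Definition _ (R : realType) := isPointed.Build (radius R)
  (exist _ 0 (introT orP (or_introl (eqxx 0)))).
HB.instance Definition _ (R : realType) := Measurable.copy (radius R)
  (g_sigma_algebra_preimageType (fun r : radius R => sval r : R)).

Section udim.
Context {R : realType} {d : measure_display} {Omega : measurableType d}.
Variables (P : probability Omega R) (Psi : Omega -> lfset R).
Local Open Scope ereal_scope.

(* An equivariant subset is an equivariant process with values in bool. *)
Definition intensity (S : eproc P Psi bool) : \bar R :=
  \int[P]_w S (Psi w) [set m | point_mark m 0%R = Some true].

Definition is_r_covering (r : R) (S : eproc P Psi bool) : Prop :=
  {ae P, forall w, {ae S (Psi w), forall m,
    forall x, pts (Psi w) x ->
      exists2 v, point_mark m v = Some true & nball (Psi w) r v x}}.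

Definition lambda (r : R) : \bar R :=
  ereal_inf [set intensity S | S in is_r_covering r].

Definition udim_M_fun (r : R) : \bar R := - lne (lambda r) * ((ln r)^-1)%:E.

Definition upper_udim_M : \bar R := limf_esup udim_M_fun +oo%R.
Definition lower_udim_M : \bar R := limf_einf udim_M_fun +oo%R.

Definition is_covering (S : eproc P Psi (radius R)) : Prop :=
  {ae P, forall w, {ae S (Psi w), forall m : marking (radius R) (Psi w),
    forall x, pts (Psi w) x ->
      exists v, exists2 rho, point_mark m v = Some rho &
        nball (Psi w) (sval rho) v x}}.

(* rho^alpha with 0^0 = 0; in the library 0 `^ 0 = 1. *)
Definition gauge (alpha : R) (rho : radius R) : R :=
  (if sval rho == 0 then 0 else sval rho `^ alpha)%R.

(* E[R(0)^alpha]; the default value is not used when 0 belongs to Psi. *)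
Definition covering_cost (alpha : R) (S : eproc P Psi (radius R)) : \bar R :=
  \int[P]_w \int[S (Psi w)]_m
    (oapp (gauge alpha) 0%R (point_mark m 0%R))%:E.

Definition Hcontent1 (alpha : R) : \bar R :=
  ereal_inf [set covering_cost alpha S | S in is_covering].

(* The maximum with 0 implements sup set0 = 0. *)
Definition udim_H : \bar R :=
  maxe 0 (ereal_sup
    [set alpha%:E | alpha in
      [set alpha | (0 <= alpha)%R /\ Hcontent1 alpha = 0]]).

End udim.

Section random_set.

Let int_finite (R : realType) (A : set int) (a b : R) :
  finite_set ([set (z%:~R : R) | z in A] `&` `[a, b]).
Proof.
pose m := Num.floor a; pose n := Num.floor b.
apply: (@sub_finite_set _ _
  ((fun k : nat => (m + k%:Z)%:~R : R) @` `I_(absz (n - m)).+1)); last first.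
  by apply: finite_image; exact: finite_II.
move=> _ [[z _ <-]]; rewrite /= in_itv/= => /andP[az zb].
have mz : m <= z by rewrite -(ler_int R) (le_trans _ az)// floor_le.
have zn : z <= n by rewrite /n floor_ge_int.
exists (absz (z - m)); last by congr (_%:~R); lia.
by rewrite /=; lia.
Qed.

(* The sign at step n is (-1)^(s n). *)
Fixpoint Tset (J : set nat) (s : nat -> bool) (n : nat) : set int :=
  if n is k.+1 then
    if `[< J k >]
    then Tset J s k `|` [set x + (-1) ^+ s k * (2 * 2 ^+ k) | x in Tset J s k]
    else Tset J s k
  else [set 0].

Definition Psi_set (R : realType) (J : set nat) (s : nat -> bool) : lfset R :=
  LFSet (@int_finite R (\bigcup_n Tset J s n)).

(* (s n), n in J, are independent fair signs *)
Definition iid_fair_signs {R : realType} {d : measure_display}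
    {Omega : measurableType d} (P : probability Omega R) (J : set nat)
    (s : nat -> Omega -> bool) : Prop :=
  [/\ forall n, J n -> measurable_fun [set: Omega] (s n),
      forall n b, J n -> P (s n @^-1` [set b]) = (2^-1)%:E &
      forall (F : {fset nat}) (A : nat -> set bool), [set` F] `<=` J ->
        P (\bigcap_(n in [set` F]) (s n @^-1` A n)) =
        (\prod_(n <- F) P (s n @^-1` A n))%E].

End random_set.

(* Main.v *)
(** Write [psum e F] for the sum over k in F of (-1)^(e k) 2^(k+1): these are
    the points of Psi, F ranging over the finite subsets of J.  Flipping the
    signs with index in F preserves the law of the signs and turns Psi into
    Psi - [psum e F], which gives point-stationarity.

    With N n := #(J cap {0, ..., n-1}), a ball of radius r in [2^n, 2^(n+1))
    around 0 contains between 2^(N (n-1)) and 3 * 2^(N n) points, whatever the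
    signs are.  Hence the growth rates are the densities of J.

    By mass transport, an r-covering has intensity at least 1 / (3 * 2^(N n)),
    and E[R(0)^alpha] is bounded below for every covering R as soon as alpha
    exceeds the upper density.  Conversely, cut the line into cells of length r
    with a uniform random offset, and keep the leftmost point of Psi in each
    cell: this is an r-covering, and averaging over the points of T_(n-1),
    which lie in at most three cells, bounds its intensity by 3 / 2^(N (n-1)). *)
Require Import Defs.
From HB Require Import structures.
From mathcomp Require Import all_boot all_order all_algebra finmap.
From mathcomp Require Import all_classical all_reals all_analysis measurable_realfun.
From mathcomp Require Import zify ring lra.

Set Implicit Arguments.
Unset Strict Implicit.
Unset Printing Implicit Defensive.

Import Order.TTheory GRing.Theory Num.Theory.
Import numFieldNormedType.Exports.

Local Open Scope classical_set_scope.
Local Open Scope ring_scope.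

(** * Signed sums of powers of two *)

(** Three points shape the details. A flip preserves the law only if its index set is deterministic,
    whereas the F with z = [psum e F] depends on the signs; since a point has only one such F, the
    event that z lies in Psi splits into countably many pieces on which F is fixed. Next, the grid
    construction must be an equivariant process, so being leftmost in a cell has to be jointly
    measurable in the configuration, the offset and the position; this is reduced to counting points
    in measurable sections. On the other hand, the cost of an arbitrary covering is not shown to be
    measurable in w, and lower bounds on it rest on monotonicity and one-sided scaling of the
    integral, valid for every nonnegative function because the integral is a supremum over simple
    functions. Finally, the Hausdorff content is an infimum over all coverings, so a single
    favourable scale makes it small: infinitely many scales where the density is large suffice, and
    its critical exponent is a limsup. *)

Lemma cardfsM (T U : choiceType) (A : {fset T}) (B : {fset U}) :
  #|` (A `*` B)%fset| = (#|` A| * #|` B|)%N.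
Proof.
rewrite -(size_allpairs pair); apply: perm_size; apply: uniq_perm => [||[x y]].
- exact: fset_uniq.
- by apply: allpairs_uniq => [||[? ?] [? ?] _ _ /=]; rewrite ?fset_uniq.
- by rewrite in_fsetM; apply/andP/allpairsP => /= [[xA yB]|[[a b] [/= aA bB [-> ->]]]];
    [exists (x, y)|].
Qed.

Section signed_sums.
Implicit Types (J : set nat) (e : nat -> bool) (F G : {fset nat}).

Definition step e (k : nat) : int := (-1) ^+ e k * (2 * 2 ^+ k).

Definition psum e F : int := \sum_(k <- F) step e k.

Definition flip F e : nat -> bool := fun k => e k (+) (k \in F).

Definition trunc J (n : nat) : {fset nat} :=
  [fset k in iota 0 n | `[< J k >]]%fset.

Lemma in_trunc J n k : (k \in trunc J n) = (k < n)%N && `[< J k >].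
Proof. by rewrite !inE /= mem_iota. Qed.

Lemma subset_truncP J n F : reflect
  ([set` F] `<=` J /\ forall k, k \in F -> (k < n)%N) (F `<=` trunc J n)%fset.
Proof.
apply: (iffP idP) => [/fsubsetP FJ|[FJ Fn]]; last apply/fsubsetP => k kF.
  by split=> k /FJ; rewrite in_trunc => /andP[] // _ /asboolP.
by rewrite in_trunc Fn//=; apply/asboolP/FJ.
Qed.

Lemma fset_nat_bounded F : exists n, forall k, k \in F -> (k < n)%N.
Proof.
exists (\max_(k <- F) k).+1 => k kF; rewrite ltnS.
by rewrite (big_fsetD1 k)//= leq_maxl.
Qed.

Lemma big_fset_nat (V : nmodType) F n (g : nat -> V) :
  (forall k, k \in F -> (k < n)%N) ->
  \sum_(k <- F) g k = \sum_(k < n | nat_of_ord k \in F) g k.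
Proof.
move=> Fn; rewrite -(big_mkord (fun k => k \in F)) -big_filter.
apply: perm_big; apply: uniq_perm => [|//|k].
- exact: fset_uniq.
- by rewrite filter_uniq// iota_uniq.
- rewrite mem_filter mem_index_iota /=; case: (boolP (k \in F)) => //= kF.
  by rewrite Fn.
Qed.

Lemma psum0 e : psum e fset0 = 0.
Proof. by rewrite /psum big_seq_fset0. Qed.

Lemma psum_ord e F n : (forall k, k \in F -> (k < n)%N) ->
  psum e F = \sum_(k < n) (nat_of_ord k \in F)%:R * step e k.
Proof.
move=> Fn; rewrite /psum (big_fset_nat _ Fn) big_mkcond /=.
by apply: eq_bigr => k _; case: ifP; rewrite ?mul1r ?mul0r.
Qed.

Lemma normr_step e k : `|step e k| = 2 ^+ k.+1.
Proof. by rewrite normrM normr_sign mul1r exprS ger0_norm ?mulr_ge0// exprn_ge0. Qed.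

(** Each index contributes its step with coefficient -1, 0 or 1, and 2 + 4 + ... + 2^n = 2^(n+1) -
    2. This stays below the step 2^(n+1) at index n, which is what separates distinct sums. *)
Lemma psum_diff_le e F G n : (forall k, k \in F -> (k < n)%N) ->
  (forall k, k \in G -> (k < n)%N) -> `|psum e F - psum e G| <= 2 ^+ n.+1 - 2.
Proof.
move=> Fn Gn; rewrite (psum_ord e Fn) (psum_ord e Gn) -sumrB.
apply: (@le_trans _ _ (\sum_(k < n) (2 ^+ k.+1 : int))).
  apply: (le_trans (ler_norm_sum _ _ _)); apply: ler_sum => k _.
  rewrite -mulrBl normrM normr_step ler_piMl ?exprn_ge0//.
  by case: (_ \in F); case: (_ \in G).
elim: n {Fn Gn} => [|n IHn]; first by rewrite big_ord0.
rewrite big_ord_recr/=; apply: (le_trans (lerD IHn (lexx _))).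
by rewrite addrAC lerD2r [leRHS]exprS mulr_natl mulr2n.
Qed.

Lemma psum_le e F n : (forall k, k \in F -> (k < n)%N) ->
  `|psum e F| <= 2 ^+ n.+1 - 2.
Proof.
move=> Fn; rewrite -[psum e F]subr0 -(psum0 e).
by apply: psum_diff_le => // k; rewrite in_fset0.
Qed.

(* At the largest index where F and G differ the sums are 2^(k+1) apart, and
   the smaller indices contribute less than that. *)
Lemma psum_inj e : injective (psum e).
Proof.
move=> F G FG.
have [n1 Fn1] := fset_nat_bounded F; have [n2 Gn2] := fset_nat_bounded G.
pose n := maxn n1 n2.
have Fn k : k \in F -> (k < n)%N by move=> /Fn1/leq_trans; apply; exact: leq_maxl.
have Gn k : k \in G -> (k < n)%N by move=> /Gn2/leq_trans; apply; exact: leq_maxr.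
suff H m (F' G' : {fset nat}) : (forall k, k \in F' -> (k < m)%N) ->
    (forall k, k \in G' -> (k < m)%N) -> psum e F' = psum e G' -> F' = G'.
  exact: (H n).
move=> {F G FG n1 Fn1 n2 Gn2 n Fn Gn}.
elim: m F' G' => [|m IHm] F G Fm Gm FG.
  by apply/fsetP => k; apply/idP/idP => [/Fm|/Gm].
have Dm (H : {fset nat}) : (forall k, k \in H -> (k < m.+1)%N) ->
    forall k, k \in (H `\ m)%fset -> (k < m)%N.
  by move=> Hm k; rewrite !inE => /andP[km /Hm]; rewrite ltnS leq_eqVlt (negbTE km).
have S (H : {fset nat}) :
    psum e H = psum e (H `\ m)%fset + (m \in H)%:R * step e m.
  have [mH|mH] := boolP (m \in H); last by rewrite mul0r addr0 mem_fsetD1.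
  by rewrite mul1r /psum (big_fsetD1 m)//= addrC.
have mFG : (m \in F) = (m \in G).
  have := psum_diff_le e (Dm _ Fm) (Dm _ Gm); have := normr_step e m.
  move: FG; rewrite S (S G).
  by case: (m \in F); case: (m \in G) => //; rewrite ?(mul0r, mul1r); lia.
have : (F `\ m = G `\ m)%fset.
  apply: IHm; [exact: Dm|exact: Dm|].
  by move: FG; rewrite S (S G) mFG => /addIr.
move=> FGm; apply/fsetP => k; have [->//|km] := eqVneq k m.
by move/fsetP/(_ k): FGm; rewrite !inE km.
Qed.

Lemma Tset_psum J e n : Tset J e n = psum e @` [set F : {fset nat} | (F `<=` trunc J n)%fset].
Proof.
elim: n => [|n IHn] /=.
  apply/seteqP; split => [_ ->|_ [F FJ <-]] /=.
    by exists fset0; rewrite ?fsub0set// /psum big_seq_fset0.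
  suff -> : F = fset0 by rewrite psum0.
  by apply/fsetP => k; apply/negbTE/negP => /(fsubsetP FJ); rewrite in_trunc.
have truncS : (trunc J n `<=` trunc J n.+1)%fset.
  by apply/fsubsetP => k; rewrite !in_trunc => /andP[kn ->]; rewrite ltnW.
have sub F : (F `<=` trunc J n.+1)%fset -> n \notin F -> (F `<=` trunc J n)%fset.
  move=> /fsubsetP FJ nF; apply/fsubsetP => k kF; move: (FJ _ kF); rewrite !in_trunc.
  rewrite ltnS leq_eqVlt => /andP[/predU1P[kn|-> ->//]].
  by move: nF; rewrite -kn kF.
case: asboolP => Jn; rewrite IHn; apply/seteqP; split.
- move=> z [[F FJ <-]|[_ [F FJ <-] <-]].
    by exists F => //=; exact: fsubset_trans truncS.
  exists (n |` F)%fset => /=.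
    apply/fsubsetP => k /fset1UP[->|/(fsubsetP FJ)/(fsubsetP truncS)//].
    by rewrite in_trunc ltnS leqnn; exact/asboolP.
  have nF : n \notin F by apply/negP => /(fsubsetP FJ); rewrite in_trunc ltnn.
  by rewrite /psum big_fsetU1//= addrC.
- move=> _ [F FJ <-]; have [nF|nF] := boolP (n \in F); last first.
    by left; exists F => //; exact: sub.
  right; exists (psum e (F `\ n)%fset).
    exists (F `\ n)%fset => //=; apply: sub; last by rewrite !inE eqxx.
    by apply: fsubset_trans FJ; exact: fsubD1set.
  by rewrite /psum [RHS](big_fsetD1 n)//= addrC.
- by move=> _ [F FJ <-]; exists F => //=; exact: fsubset_trans truncS.
- move=> _ [F FJ <-]; exists F => //; apply: sub => //.
  by apply/negP => /(fsubsetP FJ); rewrite in_trunc => /andP[_ /asboolP].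
Qed.

Definition Psi_int J e : set int := \bigcup_n Tset J e n.

Lemma Psi_intE J e : Psi_int J e = psum e @` [set F : {fset nat} | [set` F] `<=` J].
Proof.
apply/seteqP; split => [z [n _]|_ [F FJ <-]].
  by rewrite Tset_psum => -[F /subset_truncP[FJ _] <-]; exists F.
have [n Fn] := fset_nat_bounded F.
by exists n => //; rewrite Tset_psum; exists F => //; apply/subset_truncP.
Qed.

Lemma Psi_int0 J e : Psi_int J e 0.
Proof. by rewrite Psi_intE; exists fset0 => //; rewrite psum0. Qed.

(** Flipping negates exactly the steps with index in F. An index common to F and G gives minus its
    step on both sides, one in F alone cancels on the right, one in G alone is unaffected; hence the
    symmetric difference. *)
Lemma psum_flip e F G : psum (flip F e) G =
  psum e ((F `\` G) `|` (G `\` F))%fset - psum e F.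
Proof.
have [n1 Fn1] := fset_nat_bounded F; have [n2 Gn2] := fset_nat_bounded G.
pose n := maxn n1 n2.
have Fn k : k \in F -> (k < n)%N by move=> /Fn1/leq_trans; apply; exact: leq_maxl.
have Gn k : k \in G -> (k < n)%N by move=> /Gn2/leq_trans; apply; exact: leq_maxr.
rewrite !(@psum_ord _ _ n)//; last first.
  by move=> k; rewrite !inE => /orP[]/andP[_]; [exact: Fn|exact: Gn].
rewrite -sumrB; apply: eq_bigr => k _; rewrite !inE /step /flip.
by case: (_ \in F); case: (_ \in G); case: (e k); rewrite /=; ring.
Qed.

Lemma psum_flip_self e F : psum (flip F e) F = - psum e F.
Proof. by rewrite psum_flip fsetDv fsetU0 psum0 sub0r. Qed.

(** Symmetric difference with F is an involution of the finite subsets of J, so the sums for the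
    flipped signs are exactly the sums for e translated by [- psum e F]. *)
Lemma Psi_int_flip J e F z : [set` F] `<=` J ->
  Psi_int J (flip F e) z <-> Psi_int J e (z + psum e F).
Proof.
move=> FJ; rewrite !Psi_intE.
have DJ (A B : {fset nat}) : [set` A] `<=` J -> [set` B] `<=` J ->
    [set` ((A `\` B) `|` (B `\` A))%fset] `<=` J.
  by move=> AJ BJ k /=; rewrite !inE => /orP[]/andP[_]; [exact: AJ|exact: BJ].
split => [[G GJ <-]|[G GJ Gz]].
  by exists ((F `\` G) `|` (G `\` F))%fset; [exact: DJ|rewrite psum_flip subrK].
exists ((F `\` G) `|` (G `\` F))%fset; first exact: DJ.
rewrite psum_flip.
suff -> : ((F `\` ((F `\` G) `|` (G `\` F))) `|`
  (((F `\` G) `|` (G `\` F)) `\` F))%fset = G by rewrite Gz addrK.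
by apply/fsetP => k; rewrite !inE; case: (k \in F); case: (k \in G).
Qed.

Definition Jcard J n := #|` trunc J n|.

Lemma JcardS J n : (Jcard J n <= Jcard J n.+1 <= (Jcard J n).+1)%N.
Proof.
apply/andP; split.
  apply/fsubset_leq_card/fsubsetP => k.
  by rewrite !in_trunc => /andP[kn ->]; rewrite ltnW.
apply: (@leq_trans #|` n |` trunc J n|%fset).
  apply/fsubset_leq_card/fsubsetP => k; rewrite in_fset1U !in_trunc ltnS leq_eqVlt.
  by case: eqP => //= _ /andP[-> ->].
by rewrite cardfsU1 -add1n leq_add2r leq_b1.
Qed.

Lemma Jcard_le J n : (Jcard J n <= n)%N.
Proof.
elim: n => [|n IHn]; first by rewrite leqn0 cardfs_eq0; apply/eqP/fsetP => k; rewrite in_trunc.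
by have /andP[_ /leq_trans] := JcardS J n; apply; rewrite ltnS.
Qed.

Lemma counting_trunc (R : realType) J n :
  counting (J `&` `I_n) = (Jcard J n)%:R%:E :> \bar R.
Proof.
have -> : J `&` `I_n = [set` trunc J n].
  apply/seteqP; split => k /=.
    by move=> [Jk kn]; rewrite in_trunc kn; exact/asboolP.
  by rewrite in_trunc => /andP[kn /asboolP].
by rewrite /counting asboolT ?set_fsetK//; exact: finite_fset.
Qed.

Lemma dvd_psum e F n : (forall k, k \in F -> (n <= k)%N) ->
  exists q : int, psum e F = q * 2 ^+ n.+1.
Proof.
move=> Fn; suff /dvdzP[q ->] : (2 ^+ n.+1 %| psum e F)%Z by exists q.
rewrite /psum big_seq_cond; apply: rpred_sum => k; rewrite andbT => /Fn nk.
by rewrite /step -exprS dvdz_mull// dvdz_exp2l.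
Qed.

(* A point of Psi is a point of T_n plus a multiple of 2^(n+1), and only three of
   these translates of T_n meet the interval. *)
Lemma Psi_int_card J e n : exists2 A : {fset int}, (#|` A| <= 3 * 2 ^ Jcard J n)%N &
  forall z, Psi_int J e z -> `|z| < 2 ^+ n.+1 -> z \in A.
Proof.
pose Q : {fset int} := [fset (- 2 ^+ n.+1)%R; 0%R; (2 ^+ n.+1)%R]%fset.
exists [fset (p.1 + p.2)%R | p in ((psum e @` fpowerset (trunc J n)) `*` Q)%fset]%fset.
  apply: (leq_trans (leq_imfset_card _ _ _)); rewrite /= cardfsM mulnC.
  apply: leq_mul; last by apply: (leq_trans (leq_imfset_card _ _ _)); rewrite /= card_fpowerset.
  rewrite (_ : Q = seq_fset tt [:: - 2 ^+ n.+1; 0; 2 ^+ n.+1 : int]).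
    by rewrite size_seq_fset (leq_trans (size_undup _)).
  by apply/fsetP => z; rewrite !inE seq_fsetE !inE orbA.
move=> z; rewrite Psi_intE => -[F FJ <-] Fz.
pose lo := [fset k in F | (k < n)%N]%fset; pose hi := [fset k in F | (n <= k)%N]%fset.
have lon k : k \in lo -> (k < n)%N by rewrite !inE /= => /andP[].
have FE : psum e F = psum e lo + psum e hi.
  have [m Fm] := fset_nat_bounded F.
  rewrite !(@psum_ord _ _ m)//; try by move=> k; rewrite !inE /= => /andP[/Fm].
  rewrite -big_split/=; apply: eq_bigr => k _; rewrite !inE /=.
  by case: ltnP; rewrite ?(andbT, andbF) ?mul0r ?addr0 ?add0r.
have [q qE] : exists q, psum e hi = q * 2 ^+ n.+1.
  by apply: dvd_psum => k; rewrite !inE /= => /andP[].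
apply/imfsetP; exists (psum e lo, psum e hi) => //=.
rewrite in_fsetM /=; apply/andP; split.
  apply/imfsetP; exists lo => //=; rewrite fpowersetE; apply/subset_truncP.
  by split=> // k /=; rewrite !inE /= => /andP[/FJ].
have := psum_le e lon; move: Fz; rewrite FE qE !inE.
move: (psum e lo) (exprn_gt0 n.+1 (ltr0n int 2)) => x; set a := 2 ^+ n.+1 => a0 h1 h2.
have : `|q * a| < 2 * a by lia.
rewrite normrM (gtr0_norm a0) ltr_pM2r// => q2.
have : q = -1 \/ q = 0 \/ q = 1 by lia.
by move=> [->|[->|->]]; rewrite ?mulN1r ?mul0r ?mul1r eqxx ?orbT.
Qed.

End signed_sums.

(** * Counting and the law of the signs *)

Section counting.
Local Open Scope card_scope.
Context {R : realType}.

Lemma counting_card_eq (T U : choiceType) (A : set T) (B : set U) :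
  A #= B -> counting A = counting B :> \bar R.
Proof.
move=> AB; rewrite /counting; case: asboolP => [/finite_setP[n An]|Aoo].
  have Bn : B #= `I_n by rewrite (card_eq_trans _ An)// card_eq_sym.
  rewrite asboolT; last by apply/finite_setP; exists n.
  by rewrite (card_fset_set An) (card_fset_set Bn).
rewrite asboolF// => /finite_setP[n Bn]; apply: Aoo; apply/finite_setP; exists n.
exact: card_eq_trans AB Bn.
Qed.

Lemma counting_eq_natP (T : choiceType) (A : set T) (k : nat) :
  counting A = k%:R%:E :> \bar R <-> A #= `I_k.
Proof.
split => [|An]; last first.
  rewrite (counting_card_eq An) /counting asboolT; last exact: finite_II.
  by rewrite (@card_fset_set _ _ k)// card_eqxx.
rewrite /counting; case: asboolP => // fA []; move=> /eqP; rewrite eqr_nat => /eqP kE.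
by have /finite_setP[n An] := fA; rewrite -kE (card_fset_set An).
Qed.

Lemma counting_cases (T : choiceType) (A : set T) :
  (exists k : nat, counting A = k%:R%:E :> \bar R) \/ counting A = +oo%E :> \bar R.
Proof. by rewrite /counting; case: ifP => _; [left; eexists|right]. Qed.

Lemma counting_le (T : choiceType) (A B : set T) :
  A `<=` B -> (counting A <= counting B :> \bar R)%E.
Proof.
move=> AB; rewrite /counting; case: (asboolP (finite_set B)) => [fB|]; last by rewrite leey.
have fA : finite_set A by apply: sub_finite_set fB.
rewrite asboolT// lee_fin ler_nat; apply: fsubset_leq_card.
by rewrite -fset_set_sub.
Qed.

Lemma counting_fset (T : choiceType) (A : {fset T}) :
  counting [set` A] = #|` A|%:R%:E :> \bar R.
Proof. by rewrite /counting asboolT ?set_fsetK//; exact: finite_fset. Qed.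

Lemma counting_image_inj (T U : choiceType) (f : T -> U) (A : set T) :
  {in A &, injective f} -> counting (f @` A) = counting A :> \bar R.
Proof. by move=> /inj_card_eq/counting_card_eq. Qed.

(** Infinite counts are allowed. Empty factors come apart because 0 times +oo is 0; when both are
    nonempty, each factor is a projection of the product, so the product is infinite as soon as one
    factor is. *)
Lemma counting_setX (T U : choiceType) (A : set T) (B : set U) :
  counting (A `*` B) = (counting A * counting B)%E :> \bar R.
Proof.
have c0 (V : choiceType) : counting (set0 : set V) = 0%E :> \bar R.
  by rewrite /counting asboolT// fset_set0 cardfs0.
have [->|/set0P[a Aa]] := eqVneq A set0.
  by rewrite set0X c0 mul0e.
have [->|/set0P[b Bb]] := eqVneq B set0.
  by rewrite setX0 c0 c0 mule0.
have C_gt0 (V : choiceType) (C : set V) v : C v -> (0 < counting C :> \bar R)%E.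
  move=> Cv; rewrite /counting; case: asboolP => // fC.
  rewrite lte_fin ltr0n cardfs_gt0; apply/fset0Pn; exists v.
  by rewrite in_fset_set// inE.
have A0 := C_gt0 _ _ _ Aa; have B0 := C_gt0 _ _ _ Bb.
have [fA|fA] := pselect (finite_set A); last first.
  rewrite {2}/counting asboolF// gt0_mulye// /counting asboolF// => fAB.
  apply: fA; have := finite_image fst fAB; apply: sub_finite_set => x Ax.
  by exists (x, b).
have [fB|fB] := pselect (finite_set B); last first.
  rewrite [X in (_ * X)%E]/counting asboolF// gt0_muley// /counting asboolF// => fAB.
  apply: fB; have := finite_image snd fAB; apply: sub_finite_set => x Bx.
  by exists (a, x).
rewrite /counting !asboolT//; last exact: finite_setX.
by rewrite fset_setX// cardfsM natrM EFinM.
Qed.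

End counting.

Definition push_prob d d' (T : measurableType d) (T' : measurableType d')
    (R : realType) (P : probability T R) (f : T -> T')
    (mf : measurable_fun [set: T] f) : probability T' R :=
  distribution P (mfun_Sub (mem_set mf)).

(** The integral of a nonnegative function is a supremum over the simple functions below it, hence
    monotone without measurability. This serves for inner integrals over the extra randomness, whose
    measurability in w is not established. *)
Lemma ge0_le_integral_nonmeasurable d (T : measurableType d) (R : realType)
    (mu : {measure set T -> \bar R}) (f g : T -> \bar R) :
  (forall x, 0 <= f x)%E -> (forall x, f x <= g x)%E ->
  (\int[mu]_x f x <= \int[mu]_x g x)%E.
Proof.
move=> f0 fg; have g0 x : (0 <= g x)%E by exact: le_trans (fg x).
rewrite !ge0_integralTE//; apply: le_ereal_sup => _ [h /= hf <-].
by exists h => //= x; exact: le_trans (fg x).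
Qed.

Lemma lfset_eq (R : realType) (phi psi : lfset R) : pts phi = pts psi -> phi = psi.
Proof.
case: phi psi => [A fA] [B fB] /= AB; subst B; congr LFSet.
exact: Prop_irrelevance.
Qed.

(** Only coordinates in J are constrained, since measurability and independence of the signs are
    assumed for these indices alone. *)
Definition cylinders (J : set nat) : set (set (nat -> bool)) :=
  [set E | exists (F : {fset nat}) (A : nat -> set bool),
    [set` F] `<=` J /\ E = [set e | forall k, k \in F -> A k (e k)]].

Definition signs (J : set nat) := g_sigma_algebraType (cylinders J).

Lemma setI_closed_cylinders J : setI_closed (cylinders J).
Proof.
move=> _ _ [F [A [FJ ->]]] [G [B [GJ ->]]].
exists (F `|` G)%fset, (fun k => [set b | (k \in F -> A k b) /\ (k \in G -> B k b)]).
split; first by move=> k /=; rewrite inE => /orP[/FJ|/GJ].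
apply/seteqP; split => [e [/= HF HG] k _|e /= H]; first by split=> [/HF|/HG].
by split=> k kFG; have [] := H k; rewrite ?inE kFG ?orbT//; [move=> + _|move=> _]; exact.
Qed.

Section law.
Context {R : realType} {d : measure_display} {Omega : measurableType d}.
Variables (P : probability Omega R) (J : set nat) (s : nat -> Omega -> bool).
Hypothesis hs : iid_fair_signs P J s.

Let X (w : Omega) : signs J := s^~ w.

Lemma measurable_signs : measurable_fun [set: Omega] X.
Proof.
apply: (@measurability _ _ _ (signs J) _ _ (cylinders J)) => //.
move=> _ [_ [F [A [FJ ->]] <-]]; rewrite setTI.
have -> : X @^-1` [set e | forall k, k \in F -> A k (e k)] =
    \bigcap_(k in [set` F]) (s k @^-1` A k) by [].
have [ms _ _] := hs.
apply: bigcap_measurableType => k kF.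
by rewrite -[X in measurable X]setTI; apply: ms => //; exact: FJ.
Qed.

Lemma measurable_flip F : [set` F] `<=` J ->
  measurable_fun [set: signs J] (flip F : signs J -> signs J).
Proof.
move=> FJ; apply: (@measurability _ _ (signs J) (signs J) _ _ (cylinders J)) => //.
move=> _ [_ [G [A [GJ ->]] <-]]; rewrite setTI.
apply: sub_sigma_algebra; exists G, (fun k => [set b | A k (b (+) (k \in F))]).
by split.
Qed.

(** Both sides are probability measures on sign sequences, so they need only be compared on the
    cylinders, a pi-system. There independence gives a product, and each factor is unchanged because
    a fair sign and its opposite have the same law. *)
Lemma flip_law F E : [set` F] `<=` J -> measurable (E : set (signs J)) ->
  P (X @^-1` (flip F @^-1` E)) = P (X @^-1` E).
Proof.
move=> FJ mE; have [ms s2 sprod] := hs.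
have mX := measurable_signs.
pose m1 : {measure set (signs J) -> \bar R} :=
  push_prob P (measurableT_comp (measurable_flip FJ) mX).
pose m2 : {measure set (signs J) -> \bar R} := push_prob P mX.
suff : m1 E = m2 E by [].
apply: (@measure_unique _ R (signs J) (cylinders J) (fun=> setT)) => //.
- exact: setI_closed_cylinders.
- by move=> _; exists fset0, (fun=> setT); split => //; apply/seteqP; split.
- by rewrite bigcup_const.
- move=> _ [G [A [GJ ->]]].
  have prodE (B : nat -> set bool) : P (\bigcap_(k in [set` G]) (s k @^-1` B k)) =
      (\prod_(k <- G) P (s k @^-1` B k))%E by exact: sprod.
  transitivity (P (\bigcap_(k in [set` G])
      (s k @^-1` [set b | A k (b (+) (k \in F))]))) => //.
  transitivity (P (\bigcap_(k in [set` G]) (s k @^-1` A k))) => //.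
  rewrite !prodE big_seq_cond [RHS]big_seq_cond; apply: eq_bigr => k.
  rewrite andbT => kG; have Jk : J k by exact: GJ.
  case: (k \in F); last by congr (P (s k @^-1` _)); apply/seteqP; split=> b /=; rewrite addbF.
  (* A subset of [bool] changes under negation only if it is a singleton, and both singletons have
     mass 1/2. *)
  have [At|At] := pselect (A k true); have [Af|Af] := pselect (A k false).
  - by congr (P (s k @^-1` _)); apply/seteqP; split => -[].
  - rewrite (_ : [set b | A k (b (+) true)] = [set false]); last by apply/seteqP; split => -[].
    by rewrite (_ : A k = [set true]) ?s2//; apply/seteqP; split => -[].
  - rewrite (_ : [set b | A k (b (+) true)] = [set true]); last by apply/seteqP; split => -[].
    by rewrite (_ : A k = [set false]) ?s2//; apply/seteqP; split => -[].
  - by congr (P (s k @^-1` _)); apply/seteqP; split => -[].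
- by move=> _; rewrite [m1 setT](@probability_setT _ _ _ (push_prob P _)) ltry.
Qed.

Lemma integral_flip F (f : signs J -> \bar R) : [set` F] `<=` J ->
  measurable_fun [set: signs J] f -> (forall e, 0 <= f e)%E ->
  (\int[P]_w f (flip F (X w)) = \int[P]_w f (X w))%E.
Proof.
move=> FJ mf f0; have mX := measurable_signs.
have mY := measurableT_comp (measurable_flip FJ) mX.
pose Y' : {RV P >-> signs J} := mfun_Sub (mem_set mY).
pose X' : {RV P >-> signs J} := mfun_Sub (mem_set mX).
transitivity (\int[distribution P Y']_e f e)%E; first by rewrite ge0_integral_distribution.
transitivity (\int[distribution P X']_e f e)%E; last by rewrite ge0_integral_distribution.
by apply: eq_measure_integral => A mA _; exact: flip_law.
Qed.

End law.

(** * Counts over the integers as series, and translations *)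

Definition zenum (n : nat) : int := if odd n then Negz n./2 else Posz n./2.

Lemma zenum_inj : injective zenum.
Proof. by move=> m n; rewrite /zenum; do 2 case: ifP; lia. Qed.

Lemma zenum_surj z : exists n, zenum n = z.
Proof.
case: z => n; [exists n.*2|exists n.*2.+1].
  by rewrite /zenum odd_double doubleK.
by rewrite /zenum /= odd_double/= uphalf_double.
Qed.

(** Written as a series, a count is accessible to countable sums of measurable functions and to the
    exchange of sum and integral. *)
Lemma counting_int_series (R : realType) (A : set int) :
  counting A = (\sum_(n <oo) (\1_A (zenum n))%:E)%E :> \bar R.
Proof.
transitivity (counting (zenum @^-1` A) : \bar R).
  rewrite -(@counting_image_inj _ _ _ zenum); last by move=> ? ? _ _; exact: zenum_inj.
  congr counting; apply/seteqP; split => [z Az|_ [n An <-]//].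
  by have [n nz] := zenum_surj z; exists n => //=; rewrite nz.
by rewrite counting_dirac.
Qed.

Lemma measurable_lfshift (R : realType) (t : R) :
  measurable_fun [set: lfset R] (lfshift t).
Proof.
apply: (@measurability _ _ (lfset R) (lfset R) _ _ (@count_events R)) => //.
move=> _ [_ [B [k [mB ->]]] <-]; rewrite setTI; apply: sub_sigma_algebra.
exists ((fun x => x + t) @^-1` B), k; split.
  rewrite -[X in measurable X]setTI.
  by apply: (_ : measurable_fun setT (fun x : R => x + t)) => //; exact: measurable_funD.
have sE (phi : lfset R) : lfshift t phi `&` B =
    (fun x => x + t) @` (phi `&` (fun x => x + t) @^-1` B).
  apply/seteqP; split => [x /= [px Bx]|_ [x [px Bx] <-]] /=; last by rewrite addrK.
  by exists (x - t); rewrite /= ?subrK.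
apply/seteqP; split => phi /=; rewrite sE (card_eql (inj_card_eq _))// => x y _ _; exact: addIr.
Qed.

(** * Psi as a measurable function of the signs *)

Section Psi.
Context {R : realType} (J : set nat).
Implicit Types (e : signs J) (F : {fset nat}).

Lemma pts_Psi e z : pts (Psi_set R J e) z%:~R <-> Psi_int J e z.
Proof. by split => [[y yP /intr_inj <-//]|]; exists z. Qed.

Lemma Psi_flip e F : [set` F] `<=` J ->
  Psi_set R J (flip F e) = lfshift (- (psum e F)%:~R) (Psi_set R J e).
Proof.
move=> FJ; apply: lfset_eq; apply/seteqP; split => x /=.
  move=> [z /Psi_int_flip-/(_ FJ) Hz <-]; rewrite opprK -intrD.
  by exists (z + psum e F).
rewrite opprK => -[z Hz zE]; exists (z - psum e F).
  by apply/Psi_int_flip => //; rewrite subrK.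
by rewrite intrB zE addrK.
Qed.

Lemma measurable_sign k b : J k -> measurable [set e : signs J | e k = b].
Proof.
move=> Jk; apply: sub_sigma_algebra.
exists [fset k]%fset, (fun=> [set b]); split => [i /=|].
  by rewrite inE => /eqP ->.
apply/seteqP; split => e /=; first by move=> ekb i; rewrite inE => /eqP ->.
by apply; rewrite inE.
Qed.

Lemma measurable_psum F z : [set` F] `<=` J ->
  measurable [set e : signs J | psum e F = z].
Proof.
rewrite /psum => FJ; have {FJ} : forall k, k \in enum_fset F -> J k by move=> k; exact: FJ.
elim: (enum_fset F) z => [|k s IHs] z sJ.
  have [<-|z0] := eqVneq 0 z.
    by rewrite (_ : [set e | _] = setT)//; apply/seteqP; split => e //= _; rewrite big_nil.
  rewrite (_ : [set e | _] = set0)//; apply/seteqP; split => e //=; rewrite big_nil => /eqP.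
  by rewrite (negbTE z0).
have IH y : measurable [set e : signs J | \sum_(j <- s) step e j = y].
  by apply: IHs => j js; apply: sJ; rewrite in_cons js orbT.
have Jk : J k by apply: sJ; rewrite mem_head.
pose c : int := 2 * 2 ^+ k.
rewrite (_ : [set e | _] =
    ([set e : signs J | e k = false] `&` [set e | \sum_(j <- s) step e j = z - c]) `|`
    ([set e : signs J | e k = true] `&` [set e | \sum_(j <- s) step e j = z + c])).
  by apply: measurableU; apply: measurableI => //; exact: measurable_sign.
apply/seteqP; split => e /=; rewrite big_cons /step -/c.
  case: (e k); rewrite /= ?expr0 ?expr1 ?mul1r ?mulN1r => <-; [right|left]; split => //.
    by rewrite addrAC addNr add0r.
  by rewrite addrAC subrr add0r.
by move=> [|] [-> ->]; rewrite /= ?expr0 ?expr1 ?mul1r ?mulN1r; ring.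
Qed.

Definition fset_code F : nat := choice.pickle (enum_fset F : seq nat).

Lemma fset_code_inj : injective fset_code.
Proof.
move=> F G /(pcan_inj (@choice.pickleK (seq nat))) FG; apply/fsetP => k.
by have : (k \in enum_fset F) = (k \in enum_fset G) by rewrite FG.
Qed.

(** For fixed z these events partition the event that z lies in Psi, because by [psum_inj] the index
    set with sum z is unique. Numbering the finite sets by [fset_code] makes the partition a
    sequence, and F is deterministic on each piece. *)
Definition psum_event (z : int) (i : nat) : set (signs J) :=
  [set e | exists F, [/\ fset_code F = i, [set` F] `<=` J & psum e F = z]].

Lemma measurable_psum_event z i : measurable (psum_event z i).
Proof.
have [[F [Fi FJ]]|H] := pselect (exists F, fset_code F = i /\ [set` F] `<=` J).
  rewrite (_ : psum_event z i = [set e | psum e F = z]); first exact: measurable_psum.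
  apply/seteqP; split => e /=; last by exists F.
  by move=> [G [Gi GJ <-]]; rewrite -Fi in Gi; rewrite (fset_code_inj Gi).
rewrite (_ : psum_event z i = set0)//; apply/seteqP; split => e // [F [Fi FJ _]].
by apply: H; exists F.
Qed.

Lemma trivIset_psum_event z : trivIset setT (psum_event z).
Proof.
apply/trivIsetP => i j _ _; apply: contra_neqP => /eqP/set0P[e] [].
move=> [F [<- _ Fz]] [G [<- _ Gz]]; suff -> : F = G by [].
by apply: (@psum_inj e); rewrite Fz Gz.
Qed.

Lemma Psi_int_event z : [set e : signs J | Psi_int J e z] = \bigcup_i psum_event z i.
Proof.
apply/seteqP; split => e /=.
  by rewrite Psi_intE => -[F FJ Fz]; exists (fset_code F) => //; exists F.
by move=> [i _] [F [_ FJ Fz]]; rewrite Psi_intE; exists F.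
Qed.

Lemma measurable_Psi_int z : measurable [set e : signs J | Psi_int J e z].
Proof. by rewrite Psi_int_event; apply: bigcupT_measurable => i; exact: measurable_psum_event. Qed.

(** The generating events concern the number of points in a Borel set, which is a countable sum of
    indicators of the events that a given integer belongs to Psi. *)
Lemma measurable_Psi : measurable_fun [set: signs J] (Psi_set R J : signs J -> lfset R).
Proof.
apply: (@measurability _ _ (signs J) (lfset R) _ _ (@count_events R)) => //.
move=> _ [_ [B [k [mB ->]]] <-]; rewrite setTI.
pose f (e : signs J) : \bar R :=
  (\sum_(n <oo) (\1_([set z | Psi_int J e z /\ B z%:~R]) (zenum n))%:E)%E.
have -> : Psi_set R J @^-1` [set phi | (phi `&` B #= `I_k)%card] = f @^-1` [set k%:R%:E].
  have fE e : f e = counting (Psi_set R J e `&` B).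
    rewrite /f -counting_int_series -(@counting_image_inj _ _ _ (fun z => z%:~R : R)).
      congr counting; apply/seteqP; split => x /=.
        by move=> [z [Pz Bz] <-]; split => //; exists z.
      by move=> [[z Pz <-] Bz]; exists z.
    by move=> ? ? _ _; exact: intr_inj.
  by apply/seteqP; split => e /=; rewrite fE counting_eq_natP.
rewrite -[X in measurable X]setTI; have mf : measurable_fun setT f.
  apply: ge0_emeasurable_sum => [n e _ _|n _]; first by rewrite lee_fin.
  apply/measurable_EFinP.
  rewrite (_ : (fun e => _) = \1_[set e | Psi_int J e (zenum n) /\ B (zenum n)%:~R]); last first.
    by apply/funext => e; rewrite !indicE; congr (nat_of_bool _)%:R; apply/idP/idP; rewrite !inE.
  apply: measurable_indic.
  rewrite (_ : [set e | _] = [set e | Psi_int J e (zenum n)] `&` [set e | B (zenum n)%:~R])//.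
  apply: measurableI; first exact: measurable_Psi_int.
  have [Bz|Bz] := pselect (B (zenum n)%:~R).
    by rewrite (_ : [set e | _] = setT)//; apply/seteqP; split.
  by rewrite (_ : [set e | _] = set0)//; apply/seteqP; split.
exact: mf.
Qed.

End Psi.

(** * Point-stationarity and mass transport *)

Section point_stationarity.
Context {R : realType} {d : measure_display} {Omega : measurableType d}.
Variables (P : probability Omega R) (J : set nat) (s : nat -> Omega -> bool).
Hypothesis hs : iid_fair_signs P J s.

Let X (w : Omega) : signs J := s^~ w.

Lemma measurable_Psi_signs :
  measurable_fun [set: Omega] (fun w => Psi_set R J (s^~ w)).
Proof. exact: (measurableT_comp (@measurable_Psi R J) (measurable_signs hs)). Qed.

Lemma measurable_Psi_int_signs z : measurable [set w | Psi_int J (s^~ w) z].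
Proof.
rewrite -[X in measurable X]setTI.
exact: (measurable_signs hs measurableT (measurable_Psi_int z)).
Qed.

(** On the piece where z = [psum e F], the set Psi - z is Psi for the signs flipped on F, and for
    these signs the same F has sum -z. Since F is fixed on the piece, [integral_flip] applies there,
    and the pieces are summed. This is point-stationarity for a transport along the single
    displacement z. *)
Lemma point_stationary (z : int) (h : lfset R -> \bar R) :
  measurable_fun [set: lfset R] h -> (forall phi, 0 <= h phi)%E ->
  (\int[P]_(w in [set w | Psi_int J (s^~ w) z])
     h (lfshift (- z%:~R)%R (Psi_set R J (s^~ w))) =
   \int[P]_(w in [set w | Psi_int J (s^~ w) (- z)%R]) h (Psi_set R J (s^~ w)))%E.
Proof.
move=> mh h0; have mX := measurable_signs hs.
have mpre y i : measurable (X @^-1` psum_event y i).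
  by rewrite -[X in measurable X]setTI; apply: mX => //; exact: measurable_psum_event.
have tpre y : trivIset setT (fun i => X @^-1` psum_event y i).
  apply/trivIsetP => i j _ _ ij; rewrite -preimage_setI.
  by move/trivIsetP: (@trivIset_psum_event J y) => /(_ i j I I ij) ->; rewrite preimage_set0.
have preE y : [set w | Psi_int J (s^~ w) y] = \bigcup_i (X @^-1` psum_event y i).
  by rewrite -preimage_bigcup -Psi_int_event.
have mhPsi : measurable_fun [set: signs J] (h \o Psi_set R J).
  exact: measurableT_comp mh (@measurable_Psi R J).
have mhX : measurable_fun setT (fun w => h (Psi_set R J (s^~ w))).
  exact: (measurableT_comp mhPsi mX).
have mhS : measurable_fun setT (fun w => h (lfshift (- z%:~R) (Psi_set R J (s^~ w)))).
  exact: (measurableT_comp mh (measurableT_comp (@measurable_lfshift R _) measurable_Psi_signs)).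
rewrite !preE ge0_integral_bigcup//; last exact: measurable_funTS.
rewrite ge0_integral_bigcup//; last exact: measurable_funTS.
apply: eq_eseriesr => i _.
have [[F [Fi FJ]]|H] := pselect (exists F, fset_code F = i /\ [set` F] `<=` J); last first.
  have E y : psum_event y i = set0 :> set (signs J).
    apply/seteqP; split => e // [F [Fi FJ _]].
    by apply: H; exists F.
  by rewrite !E !preimage_set0 !integral_set0.
have E y : psum_event y i = [set e : signs J | psum e F = y].
  apply/seteqP; split => e /=; last by exists F.
  by move=> [G [Gi GJ <-]]; rewrite -Fi in Gi; rewrite (fset_code_inj Gi).
(* The restriction is part of the integrand, so that composing with the flip turns the condition
   that F has sum -z into the condition that it has sum z. *)
pose f : signs J -> \bar R := (h \o Psi_set R J) \_ (psum_event (- z) i).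
transitivity (\int[P]_w f (flip F (X w)))%E.
  rewrite integral_mkcond; apply: eq_integral => w _; rewrite /f !patchE !E.
  have -> : (flip F (X w) \in [set e : signs J | psum e F = - z]) =
      (w \in X @^-1` [set e : signs J | psum e F = z]).
    apply/idP/idP; rewrite !inE /= psum_flip_self; last by move=> ->.
    by move=> /oppr_inj.
  by case: ifPn => //; rewrite inE /= => <-; rewrite -Psi_flip.
rewrite (integral_flip hs)//; last 2 first.
- apply/(measurable_restrictT _ _).1 => //; first exact: measurable_psum_event.
  exact: measurable_funTS.
- by move=> e; apply: erestrict_ge0 => x _ /=.
by rewrite [RHS]integral_mkcond; apply: eq_integral.
Qed.

End point_stationarity.

(** * Marks at a point *)

Section point_marks.
Context {R : realType} {d' : measure_display} {Xi : measurableType d'}.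

(** Going through [point_mark] makes the event meaningful for every real x; it is empty when x is
    not a point of the configuration. *)
Definition mark_event (x : R) (C : set Xi) (phi : lfset R) : set (marking Xi phi) :=
  [set m | exists2 rho, point_mark m x = Some rho & C rho].

Lemma point_markE (phi : lfset R) (m : marking Xi phi) (x : R) (px : pts phi x) :
  point_mark m x = Some (m (exist _ x (mem_set px)) (exist _ x (mem_set px))).
Proof.
rewrite /point_mark; case: pselect => // px'.
by rewrite (bool_irrelevance (mem_set px') (mem_set px)).
Qed.

Lemma mark_eventE (x : R) (C : set Xi) (phi : lfset R) (px : pts phi x) :
  mark_event x C (phi := phi) =
  [set m | C (m (exist _ x (mem_set px)) (exist _ x (mem_set px)))].
Proof.
apply/seteqP; split => m /=; last by move=> Cm; eexists; first exact: point_markE.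
by move=> [rho]; rewrite (point_markE m px) => -[<-].
Qed.

Lemma mark_event_notin (x : R) (C : set Xi) (phi : lfset R) : ~ pts phi x ->
  mark_event x C (phi := phi) = set0.
Proof.
by move=> npx; apply/seteqP; split => // m [rho]; rewrite /point_mark; case: pselect.
Qed.

Lemma measurable_mark_event (x : R) (C : set Xi) (phi : lfset R) : measurable C ->
  measurable (mark_event x C (phi := phi)).
Proof.
move=> mC; have [px|npx] := pselect (pts phi x); last first.
  by rewrite mark_event_notin//; exact: measurable0.
rewrite (mark_eventE C px); apply: sub_sigma_algebra.
by exists (exist _ x (mem_set px)), (exist _ x (mem_set px)), C.
Qed.

(** With both test sets equal to {x}, only the pair (x, x) can be counted, so the event says that
    the count is 1. *)
Lemma marked_measurable_mark_event (x : R) (C : set Xi) : measurable C ->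
  marked_measurable [set q : @marked R d' Xi | mark_event x C (projT2 q)].
Proof.
move=> mC; apply: sub_sigma_algebra; exists [set x], [set x], C, 1%N; split => //.
apply/seteqP; split => -[phi m] /=.
  have [px|npx] := pselect (pts phi x); last by rewrite mark_event_notin.
  rewrite (mark_eventE C px) /= => Cm.
  rewrite (_ : [set p | _] = [set (exist _ x (mem_set px), exist _ x (mem_set px))]).
    exact: card_set1.
  apply/seteqP; split => [[u v] /= [ux vx _]|_ -> //].
  by congr pair; apply: val_inj.
move=> /eq_cardSP[[u v] /= [ux vx Cuv] _].
have px : pts phi x by rewrite -ux; exact: set_mem (valP u).
rewrite (mark_eventE C px) /=.
have -> : exist _ x (mem_set px) = u by apply: val_inj.
have uv : v = u by apply: val_inj; exact: etrans vx (esym ux).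
by rewrite -[X in m _ X]uv.
Qed.

Lemma mark_event_shift (x t : R) (C : set Xi) (phi : lfset R) :
  shift_marking t @^-1` (mark_event x C (phi := lfshift t phi)) =
  mark_event (x - t) C (phi := phi).
Proof.
have [px|npx] := pselect (pts phi (x - t)); last first.
  by rewrite !mark_event_notin ?preimage_set0.
have px' : pts (lfshift t phi) x by [].
rewrite (mark_eventE C px) (mark_eventE C px'); apply/seteqP.
have E : unshift (exist _ x (mem_set px')) = exist _ (x - t) (mem_set px).
  exact: val_inj.
by split => m; rewrite /= /shift_marking E.
Qed.

End point_marks.

(** * The mass transport principle *)

Section mass_transport.
Context {R : realType} {d : measure_display} {Omega : measurableType d}.
Variables (P : probability Omega R) (J : set nat) (s : nat -> Omega -> bool).
Hypothesis hs : iid_fair_signs P J s.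
Context {d' : measure_display} {Xi : measurableType d'}.

Let Psi w := Psi_set R J (s^~ w).

Variable Z : eproc P Psi Xi.

Lemma measurable_eproc_mark (x : R) (C : set Xi) : measurable C ->
  measurable_fun [set: lfset R] (fun phi => Z phi (mark_event x C (phi := phi)) : \bar R).
Proof. by move=> mC; exact: (eproc_measurable Z (marked_measurable_mark_event x mC)). Qed.

Lemma measurable_eproc_mark_Psi (x : R) (C : set Xi) : measurable C ->
  measurable_fun [set: Omega] (fun w => Z (Psi w) (mark_event x C (phi := Psi w)) : \bar R).
Proof.
move=> mC.
exact: (measurableT_comp (measurable_eproc_mark x mC) (measurable_Psi_signs hs)).
Qed.

(** By equivariance the mark of z in Psi has the law of the mark of 0 in Psi - z; [point_stationary]
    then replaces Psi - z by Psi and z by -z. *)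
Lemma mass_transport (z : int) (C : set Xi) : measurable C ->
  (\int[P]_w Z (Psi w) (mark_event z%:~R C (phi := Psi w)) =
   \int[P]_(w in [set w | Psi_int J (s^~ w) (- z)%R])
     Z (Psi w) (mark_event 0%R C (phi := Psi w)))%E.
Proof.
move=> mC; pose D := [set w | Psi_int J (s^~ w) z].
have mD : measurable D by exact: (measurable_Psi_int_signs hs).
rewrite -(point_stationary hs z (measurable_eproc_mark 0 mC))//.
transitivity (\int[P]_(w in D) Z (Psi w) (mark_event z%:~R C (phi := Psi w)))%E.
  rewrite [RHS]integral_mkcond; apply: eq_integral => w _; rewrite patchE.
  case: ifPn => //; rewrite notin_setE /D /= => nz.
  rewrite mark_event_notin ?measure0// => -[y Py /intr_inj yz].
  by apply: nz; rewrite -yz.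
apply: ge0_ae_eq_integral => //.
- exact/measurable_funTS/measurable_eproc_mark_Psi.
- apply: measurable_funTS.
  exact: (measurableT_comp (measurable_eproc_mark 0 mC)
    (measurableT_comp (@measurable_lfshift R _) (measurable_Psi_signs hs))).
(* Equivariance is only known on the domain of the process, hence almost everywhere. *)
- have := eproc_dom_ae Z; apply: filterS => w domw _.
  have m0 : measurable (mark_event 0 C (phi := lfshift (- z%:~R) (Psi w))).
    exact: measurable_mark_event.
  have := @eproc_equivariant R _ _ _ _ _ _ Z _ _ domw _ m0.
  by rewrite mark_event_shift opprK add0r.
Qed.

(* Every covering point of 0 receives mass from 0; by [mass_transport] the
   expected mass received by 0 is then at least 1. *)
Lemma covering_lower_bound (D : int -> set Xi) (G : Xi -> R) :
  (forall z, measurable (D z)) -> (forall rho, 0 <= G rho) ->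
  (forall e : nat -> bool, forall rho : Xi,
    (counting [set z | Psi_int J e z /\ D (- z)%R rho] <= (G rho)%:E)%E) ->
  {ae P, forall w, {ae Z (Psi w), forall m, exists2 z : int,
    Psi_int J (s^~ w) z & mark_event z%:~R (D z) (phi := Psi w) m}} ->
  (1 <= \int[P]_w \int[Z (Psi w)]_m (oapp G 0%R (point_mark m 0%R))%:E)%E.
Proof.
move=> mD G0 countG cov.
pose E w n : set (marking Xi (Psi w)) := mark_event (zenum n)%:~R (D (zenum n)) (phi := Psi w).
have mE w n : measurable (E w n) by exact: measurable_mark_event.
have mZE n : measurable_fun [set: Omega] (fun w => Z (Psi w) (E w n)).
  exact: measurable_eproc_mark_Psi.
have cov1 : {ae P, forall w, (1 <= \sum_(n <oo) Z (Psi w) (E w n))%E}.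
  apply: filterS cov => w covw.
  have mU : measurable (\bigcup_n E w n) by exact: bigcupT_measurable.
  have -> : 1%E = Z (Psi w) (\bigcup_n E w n) :> \bar R.
    rewrite -[\bigcup_n _]setCK probability_setC; last exact: measurableC.
    suff -> : Z (Psi w) (~` \bigcup_n E w n) = 0%E by rewrite sube0.
    apply/negligibleP; first exact: measurableC.
    apply: negligibleS covw => m /=; apply: contra_not => -[z _ Ez].
    by have [n nz] := zenum_surj z; exists n => //; rewrite /E nz.
  exact: measure_sigma_subadditive.
apply: (@le_trans _ _ (\int[P]_w \sum_(n <oo) Z (Psi w) (E w n))%E).
  have -> : 1%E = (\int[P]_w (cst 1 w))%E.
    by rewrite integral_cst// mul1e; exact/esym/probability_setT.
  apply: ae_ge0_le_integral => //.
  - by move=> w _; apply: nneseries_ge0 => n _ _.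
  - exact: ge0_emeasurable_sum.
  - by apply: filterS cov1.
rewrite integral_nneseries//.
pose N n := [set w | Psi_int J (s^~ w) (- zenum n)].
have mN n : measurable (N n) by exact: (measurable_Psi_int_signs hs).
(* Mass sent is exchanged for mass received, one displacement at a time. *)
under eq_eseriesr => n _.
  rewrite mass_transport// -/(N n) integral_mkcond.
  over.
rewrite /= -integral_nneseries//; last 2 first.
- move=> n; apply/(measurable_restrictT _ _).1 => //.
  exact/measurable_funTS/measurable_eproc_mark_Psi.
- by move=> n w _; apply: erestrict_ge0 => ? _.
apply: ge0_le_integral_nonmeasurable => w.
  by apply: nneseries_ge0 => n _ _; apply: erestrict_ge0 => ? _.
have -> : (\sum_(n <oo)
      ((fun w => Z (Psi w) (mark_event 0%R (D (zenum n)) (phi := Psi w))) \_ (N n)) w =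
    \int[Z (Psi w)]_m \sum_(n <oo)
      (\1_(N n) w * \1_(mark_event 0%R (D (zenum n)) (phi := Psi w)) m)%:E)%E.
  rewrite integral_nneseries//; last first.
    move=> n; apply/measurable_EFinP/measurable_funM => //.
    by apply: measurable_indic; exact: measurable_mark_event.
  apply: eq_eseriesr => n _; rewrite patchE indicE.
  case: (w \in N n); last by under eq_integral do rewrite mul0r; rewrite integral0.
  under eq_integral do rewrite mul1r.
  by rewrite integral_indic ?setIT//; exact: measurable_mark_event.
apply: ge0_le_integral_nonmeasurable => m.
  by apply: nneseries_ge0 => n _ _; rewrite lee_fin.
have p0 : pts (Psi w) 0 by have := @pts_Psi R J (s^~ w) 0; rewrite mulr0z => ->; exact: Psi_int0.
rewrite (point_markE m p0) /=; set rho := m _ _.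
apply: le_trans (countG (s^~ w) rho).
(* The displacements z with -z in Psi and rho in [D z] are the negatives of the points counted in
   the hypothesis on G. *)
rewrite -(@counting_image_inj _ _ _ -%R); last by move=> ? ? _ _; exact: oppr_inj.
rewrite counting_int_series; apply: lee_nneseries => [n _|n _]; first by rewrite lee_fin.
rewrite lee_fin !indicE -natrM ler_nat mulnb.
case: andP => //= -[]; rewrite !inE => Nw.
rewrite (mark_eventE _ p0) /= => Dm; rewrite mem_set//=.
by exists (- zenum n); rewrite opprK.
Qed.

End mass_transport.

(** * Coverings by a randomly shifted grid *)

Section translation.
Context {R : realType}.
Local Notation mu := (@lebesgue_measure R).

Lemma lebesgue_measure_translation (t : R) (A : set R) : measurable A ->
  mu ((fun u => u + t) @^-1` A) = mu A.
Proof.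
move=> mA.
have mt : @measurable_fun _ _ (measurableTypeR R) (measurableTypeR R) setT (fun u => u + t).
  exact: measurable_funD.
pose f : {mfun measurableTypeR R >-> measurableTypeR R} :=
  @mfun_Sub _ _ (measurableTypeR R) (measurableTypeR R) _ (mem_set mt).
suff : pushforward mu f A = mu A by [].
apply/esym/lebesgue_measure_unique => //= _ [[a b]] _ <-.
rewrite /pushforward.
rewrite (_ : _ @^-1` _ = `]a - t, b - t]%classic); last first.
  by apply/seteqP; split => x; rewrite /= !in_itv/= ltrBlDr lerBrDr.
rewrite !lebesgue_measure_itv/= !lte_fin ltrD2r; case: ifP => // _.
by rewrite -!EFinB; congr _%:E; lra.
Qed.

Variables (L : R) (L0 : 0 < L).

(** The endpoint L is null; the half-open interval is preferred because its translates by multiples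
    of L tile the line. *)
Lemma uniform_probE (A : set R) : measurable A ->
  uniform_prob L0 A = (L^-1%:E * mu (A `&` `[0%R, L[))%E.
Proof.
move=> mA; transitivity (\int[uniform_prob L0]_x (\1_A x)%:E)%E.
  by rewrite integral_indic// setIT.
rewrite integral_uniform//; last first.
  by apply/measurable_EFinP; exact: measurable_indic.
rewrite subr0 integral_indic//; congr (_ * _)%E.
rewrite (_ : A `&` `[0, L] = (A `&` `[0, L[) `|` (A `&` [set L])).
  rewrite measureU//; last 3 first.
  - by apply: measurableI.
  - by apply: measurableI.
  - by apply/seteqP; split => // x [[_ /=]] + [_ /= xL]; rewrite xL in_itv/= ltxx andbF.
  rewrite [X in (_ + X)%E](_ : _ = 0%E) ?adde0//.
  apply/eqP; rewrite -measure_le0 -(lebesgue_measure_set1 L).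
  by apply: le_measure => //; rewrite ?inE//; exact: measurableI.
rewrite -setIUr; congr (_ `&` _); apply/seteqP; split => x /=; rewrite !in_itv/=.
  by move=> /andP[-> /=]; rewrite le_eqVlt => /predU1P[->|->]; [right|left].
by move=> [/andP[-> /ltW//]|->]; rewrite lexx ltW.
Qed.

(** Modulo L the uniform law is the invariant measure of a circle. Once t is reduced to a t0 in [0,
    L[, the window [t0, t0 + L[ is cut at L and its right part is moved back by one period. *)
Lemma uniform_prob_periodic (t : R) (A : set R) : measurable A ->
  (forall u, A (u + L) <-> A u) ->
  uniform_prob L0 ((fun u => u + t) @^-1` A) = uniform_prob L0 A.
Proof.
move=> mA AL.
have mA' y : measurable ((fun u => u + y) @^-1` A).
  rewrite -[X in measurable X]setTI.
  by apply: (_ : measurable_fun setT (fun x : R => x + y)) => //; exact: measurable_funD.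
have ALn (n : nat) u : A (u + n%:R * L) <-> A u.
  elim: n => [|n IHn]; first by rewrite mul0r addr0.
  by rewrite -addn1 natrD mulrDl mul1r addrA AL.
have ALz (z : int) u : A (u + z%:~R * L) <-> A u.
  case: z => n; first exact: ALn.
  rewrite -(ALn n.+1 (u + _)) -addrA -mulrDl NegzE mulrNz.
  by rewrite -[_%:R]/(n.+1%:~R) addNr mul0r addr0.
pose k := Num.floor (t / L); pose t0 := t - k%:~R * L.
have -> : (fun u => u + t) @^-1` A = (fun u => u + t0) @^-1` A.
  apply/seteqP; split => u /=; rewrite -(ALz k (u + t0)) -addrA subrK//.
have t00 : 0 <= t0 by rewrite subr_ge0 -ler_pdivlMr// floor_le.
have t0L : t0 < L.
  rewrite ltrBlDl -[X in _ + X]mul1r -mulrDl -ltr_pdivrMr//.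
  by rewrite -intrD1 floorD1_gt.
rewrite !uniform_probE//; congr (_ * _)%E.
rewrite (_ : _ @^-1` A `&` `[0, L[ = (fun u => u + t0) @^-1` (A `&` `[t0, t0 + L[)); last first.
  apply/seteqP; split => x [Ax]; rewrite /= !in_itv/= => /andP[x0 xL]; split => //.
    by apply/andP; split; lra.
  by apply/andP; split; lra.
rewrite lebesgue_measure_translation; last exact: measurableI.
have split_itv a b c : a <= b -> b <= c ->
    mu (A `&` `[a, c[) = (mu (A `&` `[a, b[) + mu (A `&` `[b, c[))%E.
  move=> ab bc; rewrite -measureU//; last 3 first.
  - by apply: measurableI.
  - by apply: measurableI.
  - apply/seteqP; split => // x [[_ /=]] + [_ /=]; rewrite !in_itv/= => /andP[_ xb] /andP[bx _].
    by rewrite ltNge bx in xb.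
  rewrite -setIUr; congr (mu (_ `&` _)); apply/seteqP; split => x /=; rewrite !in_itv/=.
    by move=> /andP[ax xc]; rewrite ax xc; case: (ltP x b); [left|right].
  move=> [/andP[-> xb]|/andP[bx ->]]; rewrite /= ?andbT; first exact: lt_le_trans bc.
  exact: le_trans bx.
rewrite (split_itv _ L); [|exact: ltW|by rewrite lerDr].
rewrite (split_itv 0 t0); [|by []|exact: ltW].
rewrite addeC; congr (_ + _)%E.
rewrite -(@lebesgue_measure_translation L (A `&` `[L, t0 + L[)); last exact: measurableI.
congr (mu _); apply/seteqP; split => x /= [Ax]; rewrite !in_itv/= => /andP[? ?].
  by split; [exact/AL|apply/andP; split; lra].
by split; [exact/AL|apply/andP; split; lra].
Qed.

End translation.

(** * Measurability of point counts *)

Section count_measurability.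
Context {R : realType}.

(** Only finite counts appear among the generating events; the value +oo is reached as the
    complement of all of them. *)
Lemma measurable_count (B : set R) : measurable B ->
  measurable_fun [set: lfset R] (fun phi : lfset R => counting (B `&` pts phi) : \bar R).
Proof.
move=> mB _ Y mY; rewrite setTI.
pose E k := [set phi : lfset R | counting (B `&` pts phi) = k%:R%:E :> \bar R].
have mE k : measurable (E k).
  apply: sub_sigma_algebra; exists B, k; split => //.
  by apply/seteqP; split => phi /=; rewrite /E /= counting_eq_natP setIC.
rewrite (_ : _ @^-1` Y =
    (\bigcup_(k in [set k : nat | Y k%:R%:E]) E k) `|`
    ((~` \bigcup_k E k) `&` [set phi | Y +oo%E])).
  apply: measurableU; first exact: bigcup_measurable.
  apply: measurableI; first by apply/measurableC/bigcupT_measurable.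
  have [Yoo|Yoo] := pselect (Y +oo%E).
    by rewrite (_ : [set phi | _] = setT)//; apply/seteqP; split.
  by rewrite (_ : [set phi | _] = set0)//; apply/seteqP; split.
apply/seteqP; split => phi /=.
  have [[k phik]|phioo] := @counting_cases R _ (B `&` pts phi).
    by rewrite phik => Yk; left; exists k.
  rewrite phioo => Yoo; right; split => // -[k _]; rewrite /E /= phioo //.
move=> [[k Yk]|[nE Yoo]]; first by rewrite /E /= => ->.
have [[k phik]|->//] := @counting_cases R _ (B `&` pts phi).
by exfalso; apply: nE; exists k.
Qed.

Lemma countable_pts (phi : lfset R) : countable (pts phi).
Proof.
rewrite (_ : pts phi = \bigcup_n (pts phi `&` `[- n%:R, n%:R])).
  by apply: bigcup_countable => // n _; apply/finite_set_countable/lfset_finite.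
apply/seteqP; split => x; last by move=> [n _ []].
move=> px; exists (Num.bound `|x|) => //; split => //; rewrite /= in_itv/= -ler_norml.
by apply/ltW/archi_boundP/normr_ge0.
Qed.

Lemma countable_measurable_R (A : set R) : countable A -> measurable A.
Proof. by apply: countable_measurable => t; exact: measurable_set1. Qed.

Section parametrised.
Context {d : measure_display} {X : measurableType d} (f : X -> lfset R).
Hypothesis mf : measurable_fun [set: X] f.

Let mpts x : measurable (pts (f x)).
Proof. by apply: countable_measurable_R; exact: countable_pts. Qed.

Definition pts_kernel (x : X) : {measure set R -> \bar R} :=
  mrestr (@counting R R) (mpts x).

Let measurable_pts_kernel (U : set R) : measurable U ->
  measurable_fun [set: X] (pts_kernel ^~ U).
Proof. by move=> mU; exact: (measurableT_comp (measurable_count mU) mf). Qed.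

HB.instance Definition _ := isKernel.Build _ _ _ _ _ pts_kernel measurable_pts_kernel.

Let cell n : set R := `[(zenum n)%:~R, (zenum n)%:~R + 1[%classic.

(** The measurability of sections for a kernel, here the counting measure on the points of [f x].
    This kernel need not be finite, but local finiteness makes its restriction to a unit cell
    finite, and the unit cells partition the line. *)
Lemma measurable_count_xsection (A : set (X * R)) : measurable A ->
  measurable_fun [set: X] (fun x => counting (pts (f x) `&` xsection A x) : \bar R).
Proof.
move=> mA.
have mcell n : measurable (cell n) by exact: measurable_itv.
have -> : (fun x => counting (pts (f x) `&` xsection A x)) =
    (fun x => \sum_(n <oo) mrestr (pts_kernel x) (mcell n) (xsection A x))%E.
  apply/funext => x.
  have cE n : mrestr (pts_kernel x) (mcell n) (xsection A x) =
      counting ((pts (f x) `&` xsection A x) `&` cell n).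
    by rewrite /mrestr /pts_kernel /= /mrestr [_ `&` pts _]setIC setIA.
  under eq_eseriesr do rewrite cE.
  have mc (B : set R) : measurable (pts (f x) `&` B).
    apply: countable_measurable_R; apply: sub_countable (countable_pts (f x)).
    by apply: subset_card_le; exact: subIsetl.
  pose c : {measure set R -> \bar R} := @counting R R.
  transitivity (c (\bigcup_n ((pts (f x) `&` xsection A x) `&` cell n))).
    congr counting; rewrite -setI_bigcupr; apply/seteqP; split => y; last by case.
    move=> Ay; split => //; have [n nE] := zenum_surj (Num.floor y).
    exists n => //; rewrite /cell nE /= in_itv/= floor_le/=.
    by rewrite -intrD1 floorD1_gt.
  rewrite measure_bigcup//; last 2 first.
  - by move=> n _; rewrite -setIA; exact: mc.
  - apply/trivIsetP => i j _ _; apply: contra_neqP => /eqP/set0P[y [[_ yi] [_ yj]]].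
    move: yi yj; rewrite /cell /= !in_itv/= => yi yj.
    by apply: zenum_inj; rewrite -(floor_def (x := y) (m := zenum i)) ?intrD//;
      apply: floor_def; rewrite intrD.
  by apply: eq_eseriesl => i; rewrite in_setT.
apply: ge0_emeasurable_sum => [n x _ _|n _].
  exact: measure_ge0.
have := @measurable_prod_subset_xsection_kernel _ _ X R R pts_kernel (cell n) (mcell n).
move=> /(_ _ _ mA)[|//] x.
exists (#|` fset_set (pts (f x) `&` `[(zenum n)%:~R, (zenum n)%:~R + 1])|.+1%:R) => B mB.
rewrite /mrestr /pts_kernel /= /mrestr.
apply: (@le_lt_trans _ _ (counting (pts (f x) `&` `[(zenum n)%:~R, (zenum n)%:~R + 1]))).
  apply: counting_le => y [[By yn] py]; split => //.
  by move: yn; rewrite /cell /= !in_itv/= => /andP[-> /ltW].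
rewrite /counting asboolT; last exact: lfset_finite.
by rewrite lte_fin ltr_nat.
Qed.

End parametrised.
End count_measurability.

(** * The grid process and its equivariance *)

Section grid.
Context {R : realType} (L : R) (L0 : 0 < L).
Context {d' : measure_display} {Xi : measurableType d'} (xi0 xi1 : Xi).

Definition same_cell (u x y : R) : Prop :=
  Num.floor ((x - u) / L) = Num.floor ((y - u) / L).

Definition leader (phi : lfset R) (u x : R) : Prop :=
  forall y, pts phi y -> same_cell u x y -> x <= y.

(** The two marks are arbitrary, so that one construction gives both the subset, with marks [false]
    and [true], and the covering, with radii 0 and r. *)
Definition grid_mark (phi : lfset R) (u x : R) : Xi :=
  if `[< leader phi u x >] then xi1 else xi0.

Definition grid_marking (phi : lfset R) (u : R) : marking Xi phi :=
  fun x _ => grid_mark phi u (val x).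
Arguments grid_marking : clear implicits.

Lemma measurable_floor_eq d (T : measurableType d) (f : T -> R) (k : int) :
  measurable_fun [set: T] f -> measurable [set t | Num.floor (f t) = k].
Proof.
move=> mf; rewrite (_ : [set t | _] = f @^-1` `[k%:~R, (k + 1)%:~R[).
  by rewrite -[X in measurable X]setTI; apply: mf => //; exact: measurable_itv.
apply/seteqP; split => t /=; rewrite in_itv/=; last exact: floor_def.
by move=> <-; rewrite floor_le floorD1_gt.
Qed.

Lemma measurable_cell_index d (T : measurableType d) (f g : T -> R) (k : int) :
  measurable_fun [set: T] f -> measurable_fun [set: T] g ->
  measurable [set t | Num.floor ((f t - g t) / L) = k].
Proof.
move=> mf mg; apply: measurable_floor_eq.
by apply: measurable_funM => //; exact: measurable_funB.
Qed.

(** A leader is a position for which some measurable section contains no point of the configuration,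
    so [measurable_count_xsection] gives joint measurability in configuration, offset and
    position. *)
Lemma measurable_leader :
  measurable [set p : lfset R * R * R | leader p.1.1 p.1.2 p.2].
Proof.
pose A := [set q : (lfset R * R * R) * R | q.2 < q.1.2 /\ same_cell q.1.1.2 q.1.2 q.2].
have mx : measurable_fun setT (fun q : (lfset R * R * R) * R => q.1.2).
  exact: (measurableT_comp measurable_snd measurable_fst).
have mu : measurable_fun setT (fun q : (lfset R * R * R) * R => q.1.1.2).
  exact: (measurableT_comp measurable_snd (measurableT_comp measurable_fst measurable_fst)).
have my : measurable_fun setT (fun q : (lfset R * R * R) * R => q.2).
  exact: measurable_snd.
have mA : measurable A.
  rewrite (_ : A = [set q | q.2 < q.1.2] `&` \bigcup_n
    ([set q : (lfset R * R * R) * R | Num.floor ((q.1.2 - q.1.1.2) / L) = zenum n] `&`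
     [set q : (lfset R * R * R) * R | Num.floor ((q.2 - q.1.1.2) / L) = zenum n])).
    apply: measurableI.
      have := measurable_fun_ltr my mx; move=> /(_ measurableT [set true] I).
      by rewrite setTI.
    by apply: bigcupT_measurable => n; apply: measurableI; exact: measurable_cell_index.
  apply/seteqP; split => q [q1 q2]; split => //.
    have [n nE] := zenum_surj (Num.floor ((q.2 - q.1.1.2) / L)).
    by exists n => //; split => //=; rewrite nE.
  by move: q2 => [n _ [/= a1 a2]]; rewrite /same_cell a1 a2.
have mp : measurable_fun setT (fun p : lfset R * R * R => p.1.1).
  exact: (measurableT_comp measurable_fst measurable_fst).
have := measurable_count_xsection mp mA; move=> /(_ measurableT [set 0%E] (emeasurable_set1 _)).
rewrite setTI; congr measurable; apply/seteqP; split => p /=;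
  rewrite -[0%E]/(0%:R%:E) counting_eq_natP II0 card_eq0.
  move=> /eqP pA y py pxy; rewrite leNgt; apply/negP => yx.
  suff : (set0 : set R) y by [].
  by rewrite -pA; split => //; rewrite /xsection /= inE.
move=> lead; apply/eqP/seteqP; split => // y [py].
rewrite /xsection /= inE => -[/= yx] /(lead _ py).
by rewrite leNgt yx.
Qed.

Lemma measurable_grid_mark (C : set Xi) :
  measurable [set p : lfset R * R * R | C (grid_mark p.1.1 p.1.2 p.2)].
Proof.
have mc (Q : Prop) : measurable [set _ : lfset R * R * R | Q].
  have [q|q] := pselect Q.
    by rewrite (_ : [set _ | _] = setT)//; apply/seteqP; split.
  by rewrite (_ : [set _ | _] = set0)//; apply/seteqP; split.
rewrite (_ : [set p | _] =
  ([set p : lfset R * R * R | leader p.1.1 p.1.2 p.2] `&` [set _ | C xi1]) `|`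
  (~` [set p : lfset R * R * R | leader p.1.1 p.1.2 p.2] `&` [set _ | C xi0])).
  apply: measurableU; apply: measurableI => //; first exact: measurable_leader.
  by apply: measurableC; exact: measurable_leader.
apply/seteqP; split => p /=; rewrite /grid_mark; case: asboolP => ?.
- by left.
- by right.
- by case=> [[]|[]].
- by case=> [[]|[]].
Qed.

Lemma measurable_grid_marking (phi : lfset R) :
  measurable_fun [set: R] (grid_marking phi : R -> marking Xi phi).
Proof.
apply: (@measurability _ _ _ (marking Xi phi) _ _ (@cylinder_events R d' Xi phi)) => //.
move=> _ [_ [x [y [C [mC ->]]]] <-]; rewrite setTI.
have mf : measurable_fun setT (fun u : R => (phi, u, val x)).
  by apply: measurable_fun_pair => //; apply: measurable_fun_pair.
have := mf measurableT _ (measurable_grid_mark C).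
by rewrite setTI.
Qed.

Definition grid_law (phi : lfset R) : probability (marking Xi phi) R :=
  push_prob (uniform_prob L0) (@measurable_grid_marking phi).

Lemma grid_lawE phi (E : set (marking Xi phi)) :
  grid_law phi E = uniform_prob L0 [set u | E (grid_marking phi u)].
Proof. by []. Qed.

(** It suffices to treat the generating events. There the counted pairs form a product set because
    the mark of a pair ignores its second point, and the count is a product of two counts of
    sections. *)
Lemma measurable_grid_pairs (A : set (@marked R d' Xi)) : marked_measurable A ->
  measurable [set p : lfset R * R | A (existT _ p.1 (grid_marking p.1 p.2))].
Proof.
pose S := [set A : set (@marked R d' Xi) |
  measurable [set p : lfset R * R | A (existT _ p.1 (grid_marking p.1 p.2))]].
suff : marked_measurable `<=` S by apply.
apply: smallest_sub.
  split.
  - exact: measurable0.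
  - move=> B mB; rewrite /S /= (_ : [set p | _] =
      ~` [set p : lfset R * R | B (existT _ p.1 (grid_marking p.1 p.2))]).
      exact: measurableC.
    by apply/seteqP; split => p /=; [case|split].
  - move=> F mF; rewrite /S /= (_ : [set p | _] =
      \bigcup_n [set p : lfset R * R | F n (existT _ p.1 (grid_marking p.1 p.2))])//.
    exact: bigcupT_measurable.
move=> _ [B1 [B2 [C [k [mB1 mB2 mC ->]]]]].
pose A1 := [set p : lfset R * R * R | B1 p.2 /\ C (grid_mark p.1.1 p.1.2 p.2)].
have mA1 : measurable A1.
  apply: measurableI; last exact: measurable_grid_mark.
  by rewrite -[X in measurable X]setTI; exact: measurable_snd.
pose A2 := [set p : lfset R * R * R | B2 p.2].
have mA2 : measurable A2.
  by rewrite -[X in measurable X]setTI; exact: measurable_snd.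
pose c1 (p : lfset R * R) : \bar R := counting (pts p.1 `&` xsection A1 p).
pose c2 (p : lfset R * R) : \bar R := counting (pts p.1 `&` xsection A2 p).
have mc : measurable_fun setT (fun p => (c1 p * c2 p)%E).
  apply: emeasurable_funM; apply: measurable_count_xsection => //; exact: measurable_fst.
have := mc measurableT [set k%:R%:E] (emeasurable_set1 _).
rewrite setTI /S /=; congr measurable; apply/seteqP.
have E p : (c1 p * c2 p)%E = counting
    [set q : set_type (pts p.1) * set_type (pts p.1) |
     [/\ B1 (val q.1), B2 (val q.2) & C (grid_marking p.1 p.2 q.1 q.2)]].
  rewrite (_ : [set q | _] =
    [set a : set_type (pts p.1) | B1 (val a) /\ C (grid_mark p.1 p.2 (val a))] `*`
    [set b : set_type (pts p.1) | B2 (val b)]); last first.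
    by apply/seteqP; split => -[a b] /=; [case|case=> -[]].
  rewrite counting_setX /c1 /c2; congr (_ * _)%E.
    rewrite -(@counting_image_inj _ _ _ val); last by move=> ? ? _ _; exact: val_inj.
    congr counting; apply/seteqP; split => x /=.
      by move=> [px]; rewrite /xsection /= inE => -[B1x Cx]; exists (exist _ x (mem_set px)).
    by move=> [[y py] /= [B1y Cy] <-]; rewrite /xsection /= inE; split => //; exact: set_mem.
  rewrite -(@counting_image_inj _ _ _ val); last by move=> ? ? _ _; exact: val_inj.
  congr counting; apply/seteqP; split => x /=.
    by move=> [px]; rewrite /xsection /= inE => B2x; exists (exist _ x (mem_set px)).
  by move=> [[y py] /= B2y <-]; rewrite /xsection /= inE; split => //; exact: set_mem.
by split => p /=; rewrite E counting_eq_natP.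
Qed.

Lemma same_cell_shift t u x y : same_cell (u + t) (x + t) (y + t) <-> same_cell u x y.
Proof.
have E v : v + t - (u + t) = v - u by ring.
by rewrite /same_cell !E.
Qed.

Lemma leader_shift t phi u x : leader (lfshift t phi) (u + t) x <-> leader phi u (x - t).
Proof.
split => lead y py.
  rewrite -(same_cell_shift t) subrK => xy.
  by rewrite lerBlDr; apply: lead xy; rewrite /= addrK.
rewrite -{1}(subrK t x) -{1}(subrK t y) same_cell_shift => /(lead _ py).
by rewrite lerD2r.
Qed.

Lemma grid_marking_shift t phi u :
  shift_marking t (grid_marking phi u) = grid_marking (lfshift t phi) (u + t).
Proof.
apply/funext => x; apply/funext => y; rewrite /shift_marking /grid_marking /grid_mark /=.
by congr (if _ then _ else _); apply/asboolP/asboolP => /leader_shift.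
Qed.

Lemma grid_marking_periodic phi u : grid_marking phi (u + L) = grid_marking phi u.
Proof.
apply/funext => x; apply/funext => y; rewrite /grid_marking /grid_mark /=.
have E z w : same_cell (u + L) z w <-> same_cell u z w.
  have H v : Num.floor ((v - (u + L)) / L) = Num.floor ((v - u) / L) - 1.
    rewrite opprD addrA mulrBl divff ?gt_eqF//.
    by rewrite -[_ - 1]/(_ + -1) floorDrz ?rpredN1// floorN ?floor1// rpred1.
  by rewrite /same_cell !H; split => [/addIr|->].
by congr (if _ then _ else _); apply/asboolP/asboolP => lead z pz /E; exact: lead.
Qed.

Let grid_law_measurable A : marked_measurable A ->
  measurable_fun [set: lfset R]
    (fun phi => grid_law phi [set m | A (existT _ phi m)] : \bar R).
Proof.
move=> /measurable_grid_pairs mA.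
rewrite (_ : (fun phi => _) = fun phi => uniform_prob L0
  (xsection [set p : lfset R * R | A (existT _ p.1 (grid_marking p.1 p.2))] phi)).
  exact: measurable_fun_xsection.
apply/funext => phi; rewrite grid_lawE; congr uniform_prob.
by apply/seteqP; split => u; rewrite /xsection /= inE.
Qed.

(** Translating the configuration by t amounts to translating the offset by t; the marking is
    L-periodic in the offset, so the uniform law absorbs this translation. *)
Let grid_law_equivariant t phi (C : set (marking Xi (lfshift t phi))) :
  measurable C ->
  grid_law phi (shift_marking t @^-1` C) = grid_law (lfshift t phi) C.
Proof.
move=> mC; rewrite !grid_lawE.
rewrite -(@uniform_prob_periodic _ _ L0 t [set u | C (grid_marking (lfshift t phi) u)]).
- by congr uniform_prob; apply/seteqP; split => u /=; rewrite grid_marking_shift.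
- rewrite -[X in measurable X]setTI; exact: measurable_grid_marking.
- by move=> u /=; rewrite grid_marking_periodic.
Qed.

Definition grid_eproc {d : measure_display} {Omega : measurableType d}
    (P : probability Omega R) (Psi : Omega -> lfset R) : eproc P Psi Xi :=
  @EProc R d d' Omega P Psi Xi setT grid_law
    (aeW P (fun w => I)) (fun _ _ _ => I) grid_law_measurable
    (fun t phi _ => @grid_law_equivariant t phi).

End grid.

Lemma seq_min (R : realType) (s : seq R) : s != [::] ->
  exists2 v, v \in s & forall y, y \in s -> v <= y.
Proof.
elim: s => // x [|y s] IH _.
  by exists x; rewrite ?mem_head// => y; rewrite inE => /eqP ->.
have [v vs vmin] := IH isT; have [xv|vx] := leP x v.
  exists x; rewrite ?mem_head// => z; rewrite inE => /predU1P[->//|/vmin].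
  exact: le_trans.
by exists v; [rewrite inE vs orbT|move=> z; rewrite inE => /predU1P[->|/vmin//]; exact: ltW].
Qed.

(** * Leaders and the intensity of the grid process *)

Section grid_estimates.
Context {R : realType} (L : R) (L0 : 0 < L).

Lemma same_cell_dist u x y : same_cell L u x y -> `|x - y| < L.
Proof.
rewrite /same_cell => xy.
have /andP[x1 x2] := real_floor_itv (num_real ((x - u) / L)).
have /andP[y1 y2] := real_floor_itv (num_real ((y - u) / L)).
move: x1 x2 y1 y2; rewrite xy; set k := Num.floor _.
rewrite intrD !ler_pdivlMr// !ltr_pdivrMr// !mulrDl !mul1r => x1 x2 y1 y2.
by rewrite ltr_norml; apply/andP; split; lra.
Qed.

Lemma leader_exists (phi : lfset R) u x : pts phi x ->
  exists v, [/\ pts phi v, leader L phi u v & `|x - v| < L].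
Proof.
move=> px; pose A := [set y | pts phi y /\ same_cell L u x y].
have fA : finite_set A.
  apply: sub_finite_set (lfset_finite phi (x - L) (x + L)) => y [py /same_cell_dist].
  rewrite ltr_norml => /andP[? ?]; split => //; rewrite /= in_itv/=.
  by apply/andP; split; lra.
have Ax : A x by [].
have [|v] := @seq_min R (fset_set A).
  apply/eqP => A0; have : x \in fset_set A by rewrite in_fset_set// inE.
  by rewrite -[_ \in _]/(x \in enum_fset _) A0.
rewrite -[v \in _]/(v \in fset_set A) in_fset_set// inE => -[pv xv] vmin.
exists v; split => //; last exact: same_cell_dist xv.
move=> y py vy; apply: vmin; rewrite -[y \in _]/(y \in fset_set A) in_fset_set// inE.
by split => //; exact: etrans vy.
Qed.

Lemma leader_uniq (phi : lfset R) u x y : pts phi x -> pts phi y ->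
  leader L phi u x -> leader L phi u y -> same_cell L u x y -> x = y.
Proof.
by move=> px py lx ly xy; apply/eqP; rewrite eq_le lx//= ly.
Qed.

Context {d' : measure_display} {Xi : measurableType d'} (xi0 xi1 : Xi).

Lemma grid_law_mark_event (phi : lfset R) (x : R) (C : set Xi) : pts phi x ->
  C xi1 -> ~ C xi0 ->
  grid_law L0 xi0 xi1 phi (mark_event x C (phi := phi)) =
  uniform_prob L0 [set u | leader L phi u x].
Proof.
move=> px C1 C0; rewrite grid_lawE (mark_eventE C px); congr uniform_prob.
by apply/seteqP; split => u /=; rewrite /grid_marking /grid_mark /=; case: asboolP.
Qed.

Lemma measurable_leader_section (phi : lfset R) x : measurable [set u | leader L phi u x].
Proof.
have mf : measurable_fun setT (fun u : R => (phi, u, x)).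
  by apply: measurable_fun_pair => //; apply: measurable_fun_pair.
have := mf measurableT _ (@measurable_leader R L).
by rewrite setTI.
Qed.

(** Distinct leaders lie in distinct cells, so [c] is injective on A. The points of T_m have
    absolute value less than 2^(m+1) <= L, so their cells are among the cell of 0 and its two
    neighbours. *)
Lemma leader_card (J : set nat) (e : nat -> bool) (m : nat) (u : R) : 2 ^+ m.+1 <= L ->
  (#|` [fset F in fpowerset (trunc J m) |
      `[< leader L (Psi_set R J e) u (psum e F)%:~R >] ]%fset| <= 3)%N.
Proof.
move=> mL; set A := (X in #|` X|); pose c F := Num.floor (((psum e F)%:~R - u) / L : R).
have AP F : F \in A -> [/\ (F `<=` trunc J m)%fset,
    pts (Psi_set R J e) (psum e F)%:~R & leader L (Psi_set R J e) u (psum e F)%:~R].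
  rewrite !inE /= fpowersetE => /andP[FJ /asboolP]; split => //.
  by apply/pts_Psi; rewrite Psi_intE; exists F => //; move/subset_truncP: FJ => [].
pose k0 := Num.floor (- u / L).
have <- : #|` [fset c F | F in A]%fset| = #|` A|.
  apply: card_in_imfset => F G /AP[_ pF lF] /AP[_ pG lG] cFG.
  by apply: (@psum_inj e); apply: (@intr_inj R); exact: leader_uniq pF pG lF lG cFG.
pose S : {fset int} := [fset z in [:: (k0 - 1)%R; k0; (k0 + 1)%R]]%fset.
apply: (@leq_trans #|` S|); last first.
  by rewrite card_fseq (leq_trans (size_undup _)).
apply/fsubset_leq_card/fsubsetP => _ /imfsetP[F /= /AP[/subset_truncP[_ Fm] _ _] ->].
have FL : `|(psum e F)%:~R / L : R| < 1.
  rewrite normrM normfV (gtr0_norm L0) ltr_pdivrMr// mul1r.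
  apply: lt_le_trans mL; rewrite -intr_norm.
  apply: (@le_lt_trans _ _ ((2 ^+ m.+1 - 2)%:~R)); first by rewrite ler_int psum_le.
  by rewrite intrB rmorphXn /= ltrBlDr ltrDl.
have : `|c F - k0| <= 1.
  rewrite /c /k0 mulrBl -mulNr.
  have /andP[a1 a2] := real_floor_itv (num_real ((psum e F)%:~R / L - u / L : R)).
  have /andP[b1 b2] := real_floor_itv (num_real (- u / L : R)).
  move: FL; rewrite ltr_norml => /andP[F1 F2].
  move: a1 a2 b1 b2; rewrite !mulNr; set a := Num.floor _; set b := Num.floor _.
  rewrite !intrD => a1 a2 b1 b2.
  have : a < b + 2 by rewrite -(ltr_int R) intrD; lra.
  have : b < a + 2 by rewrite -(ltr_int R) intrD; lra.
  lia.
by rewrite !inE; lia.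
Qed.

Context {d : measure_display} {Omega : measurableType d}.
Variables (P : probability Omega R) (J : set nat) (s : nat -> Omega -> bool).
Hypothesis hs : iid_fair_signs P J s.

Let Psi w := Psi_set R J (s^~ w).

(* Averaging over the translates of 0 in T_m: the 2^(Jcard J m) points of T_m
   meet at most three cells. *)
Lemma grid_intensity (C : set Xi) (m : nat) : measurable C -> C xi1 -> ~ C xi0 ->
  2 ^+ m.+1 <= L ->
  (\int[P]_w grid_law L0 xi0 xi1 (Psi w) (mark_event 0%R C (phi := Psi w)) <=
   (3 / 2 ^+ Jcard J m)%:E)%E.
Proof.
move=> mC C1 C0 mL.
pose h (phi : lfset R) := grid_law L0 xi0 xi1 phi (mark_event 0%R C (phi := phi)).
pose Z := grid_eproc L0 xi0 xi1 P Psi.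
have mh : measurable_fun [set: lfset R] (h : _ -> \bar R).
  exact: (measurable_eproc_mark Z 0 mC).
(* Flipping the signs in F moves the point [psum e F] to the origin. *)
have shiftE F w : [set` F] `<=` J -> h (Psi_set R J (flip F (s^~ w))) =
    uniform_prob L0 [set u | leader L (Psi w) u (psum (s^~ w) F)%:~R].
  move=> FJ; rewrite Psi_flip// /h.
  have mE : measurable (mark_event 0 C (phi := lfshift (- (psum (s^~ w) F)%:~R) (Psi w))).
    exact: measurable_mark_event.
  have E := @eproc_equivariant _ _ _ _ _ _ _ Z _ _ I _ mE.
  rewrite mark_event_shift opprK add0r in E.
  transitivity (grid_law L0 xi0 xi1 (Psi w)
    (mark_event (psum (s^~ w) F)%:~R C (phi := Psi w))); first exact/esym/E.
  by apply: grid_law_mark_event => //; apply/pts_Psi; rewrite Psi_intE; exists F.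
have flipE F : [set` F] `<=` J -> (\int[P]_w h (Psi_set R J (flip F (s^~ w))) =
    \int[P]_w h (Psi w))%E.
  move=> FJ; apply: (integral_flip hs FJ (f := h \o Psi_set R J)) => //.
  exact: (measurableT_comp mh (@measurable_Psi R J)).
pose N := Jcard J m.
have FJ F : F \in fpowerset (trunc J m) -> [set` F] `<=` J.
  by rewrite fpowersetE => /subset_truncP[].
have mhF F : [set` F] `<=` J -> measurable_fun setT (fun w => h (Psi_set R J (flip F (s^~ w)))).
  move=> FJ'.
  exact: (measurableT_comp mh (measurableT_comp (@measurable_Psi R J)
    (measurableT_comp (measurable_flip FJ') (measurable_signs hs)))).
have : ((2 ^ N)%:R%:E * \int[P]_w h (Psi w) <= 3%:E)%E.
  have -> : ((2 ^ N)%:R%:E * \int[P]_w h (Psi w) =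
      \sum_(F <- fpowerset (trunc J m)) \int[P]_w h (Psi_set R J (flip F (s^~ w))))%E.
    rewrite big_seq_cond (eq_bigr (fun=> \int[P]_w h (Psi w)))%E; last first.
      by move=> F; rewrite andbT => /FJ; exact: flipE.
    rewrite -big_seq_cond big_const_seq count_predT card_fpowerset -/N.
    elim: (2 ^ N)%N => [|n IHn]; first by rewrite mul0e.
    by rewrite iterS -IHn -[in LHS]add1n natrD EFinD ge0_muleDl ?lee_fin// mul1e.
  (* Extension by zero gives a measurable function for every finite set F, not only for the subsets
     of J. *)
  pose g (F : {fset nat}) w :=
    if F \in fpowerset (trunc J m) then h (Psi_set R J (flip F (s^~ w))) else 0%E.
  rewrite (eq_big_seq (fun F => \int[P]_w g F w)%E); last first.
    by move=> F FP; rewrite /g FP.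
  rewrite -ge0_integral_sum//; last 2 first.
  - move=> F; rewrite /g; case: (boolP (F \in fpowerset _)) => [FP|_]; last exact: measurable_cst.
    exact: mhF (FJ _ FP).
  - by move=> F w _; rewrite /g; case: ifP.
  have -> : 3%:E = (\int[P]_w (cst 3%:E w))%E.
    rewrite integral_cst// -[LHS]mule1; congr (_ * _)%E.
    exact/esym/probability_setT.
  apply: ge0_le_integral_nonmeasurable => w.
    by apply: sume_ge0 => F _; rewrite /g; case: ifP.
  (* For a fixed configuration and offset u, the sum over F counts the leaders in T_m. *)
  pose A F := [set u | leader L (Psi w) u (psum (s^~ w) F)%:~R].
  rewrite (eq_big_seq (fun F => \int[uniform_prob L0]_u (\1_(A F) u)%:E)%E); last first.
    move=> F FP; rewrite /g FP shiftE; last exact: FJ.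
    by rewrite integral_indic ?setIT//; exact: measurable_leader_section.
  rewrite -ge0_integral_sum//; last first.
    by move=> F; apply/measurable_EFinP/measurable_indic; exact: measurable_leader_section.
  have -> : (cst 3%:E w = \int[uniform_prob L0]_u (cst 3%:E u))%E.
    rewrite integral_cst// -[LHS]mule1; congr (_ * _)%E.
    exact/esym/probability_setT.
  apply: ge0_le_integral_nonmeasurable => u.
    by apply: sume_ge0 => F _; rewrite lee_fin.
  rewrite sumEFin lee_fin.
  have := leader_card J (s^~ w) u mL; rewrite -(ler_nat R); apply: le_trans.
  rewrite card_fset_sum1 natr_sum big_fset/= [leRHS]big_mkcond/=.
  apply: ler_sum => F _; rewrite indicE.
  by case: (boolP (u \in A F)) => [|_]; [rewrite inE => uA; rewrite asboolT|case: ifP].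
rewrite -lee_pdivlMl ?ltr0n ?expn_gt0//; move=> /le_trans; apply.
by rewrite -EFinM lee_fin natrX mulrC.
Qed.

End grid_estimates.

(** * Growth along powers of two *)

Section limsup.
Context {R : realType}.
Implicit Types (a b : \bar R).

Lemma near_limf_esup_lt (T : choiceType) (X : filteredType T) (F : set_system X)
    {FF : Filter F} (f : X -> \bar R) a :
  (limf_esup f F < a)%E -> \forall x \near F, (f x < a)%E.
Proof.
move=> /ereal_inf_lt[_ [V FV <-] Va]; apply: filterS FV => x Vx.
by apply: le_lt_trans Va; apply: ereal_sup_ubound; exists x.
Qed.

Lemma limf_esup_le_near (T : choiceType) (X : filteredType T) (F : set_system X)
    (f : X -> \bar R) a :
  (\forall x \near F, (f x <= a)%E) -> (limf_esup f F <= a)%E.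
Proof.
move=> fa; apply: (@le_trans _ _ (ereal_sup (f @` [set x | (f x <= a)%E]))).
  by apply: ereal_inf_lbound; eexists; first exact: fa.
by apply: ge_ereal_sup => _ [x fx <-].
Qed.

Lemma lt_ereal_dense a b : (a < b)%E -> exists c : R, (a < c%:E < b)%E.
Proof.
case: a b => [x| |] [y| |]//.
- by rewrite lte_fin => xy; exists ((x + y) / 2); rewrite !lte_fin; apply/andP; split; lra.
- by move=> _; exists (x + 1); rewrite lte_fin ltry andbT; lra.
- by move=> _; exists (y - 1); rewrite lte_fin ltNyr /=; lra.
- by move=> _; exists 0; rewrite ltNyr ltry.
Qed.

(** Here [nu x] is the scale of x and [sigma] picks a point of each scale. The bounds on g at large
    scales control the limsup along F from above, and evaluation at [sigma k] shows that no scale is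
    missed. The general filter covers real and integer radii alike. *)
Lemma limf_esup_eq_limn_esup (T : choiceType) (X : filteredType T)
    (F : set_system X) {FF : Filter F} (g : X -> \bar R) (q eps : nat -> R)
    (nu : X -> nat) (sigma : nat -> X) :
  (\forall x \near F, ((q (nu x) - eps (nu x))%:E <= g x <= (q (nu x) + eps (nu x))%:E)%E) ->
  (forall n, \forall x \near F, (n <= nu x)%N) ->
  (forall V, F V -> \forall k \near \oo, V (sigma k)) ->
  (forall k, nu (sigma k) = k) -> eps @ \oo --> 0 ->
  limf_esup g F = limn_esup (EFin \o q).
Proof.
move=> gq nuoo sigmaF nuK eps0.
have nearF (Q : nat -> Prop) : (\forall n \near \oo, Q n) -> \forall x \near F, Q (nu x).
  by move=> [n _ Qn]; apply: filterS (nuoo n) => x; exact: Qn.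
have near_eps c : 0 < c -> \forall n \near \oo, eps n < c.
  move=> c0; move/cvgrPdist_lt: eps0 => /(_ c c0); apply: filterS => n.
  by rewrite sub0r normrN; apply: le_lt_trans; exact: ler_norm.
apply/eqP; rewrite eq_le; apply/andP; split; rewrite leNgt; apply/negP.
  move=> /lt_ereal_dense[c2 /andP[/lt_ereal_dense[c1 /andP[qc1 c12]] c2g]].
  rewrite lte_fin in c12.
  have near_q := near_limf_esup_lt qc1.
  suff : (limf_esup g F <= c2%:E)%E by rewrite leNgt c2g.
  apply: limf_esup_le_near.
  have /nearF H : \forall n \near \oo, q n + eps n <= c2.
    near=> n; have : q n < c1 by rewrite -lte_fin; near: n; exact: near_q.
    have : eps n < c2 - c1 by near: n; apply: near_eps; rewrite subr_gt0.
    lra.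
  apply: filterS2 gq H => x /andP[_ gx] qx; apply: le_trans gx _.
  by rewrite lee_fin.
move=> /lt_ereal_dense[c2 /andP[/lt_ereal_dense[c1 /andP[gc1 c12]] c2q]].
rewrite lte_fin in c12.
have near_g := near_limf_esup_lt (FF := FF) gc1.
suff : (limn_esup (EFin \o q) <= c2%:E)%E by rewrite leNgt c2q.
apply: limf_esup_le_near.
have {}gq : \forall x \near F, ((q (nu x) - eps (nu x))%:E <= g x)%E.
  by apply: filterS gq => x /andP[].
have H := sigmaF _ (filterI gq near_g).
near=> n; rewrite /= lee_fin.
have : ((q (nu (sigma n)) - eps (nu (sigma n)))%:E <= g (sigma n))%E /\
    (g (sigma n) < c1%:E)%E by near: n; exact: H.
rewrite nuK => -[qg gc]; have := le_lt_trans qg gc; rewrite lte_fin.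
have : eps n < c2 - c1 by near: n; apply: near_eps; rewrite subr_gt0.
lra.
Unshelve. all: by end_near. Qed.

Lemma limf_einf_eq_limn_einf (T : choiceType) (X : filteredType T)
    (F : set_system X) {FF : Filter F} (g : X -> \bar R) (q eps : nat -> R)
    (nu : X -> nat) (sigma : nat -> X) :
  (\forall x \near F, ((q (nu x) - eps (nu x))%:E <= g x <= (q (nu x) + eps (nu x))%:E)%E) ->
  (forall n, \forall x \near F, (n <= nu x)%N) ->
  (forall V, F V -> \forall k \near \oo, V (sigma k)) ->
  (forall k, nu (sigma k) = k) -> eps @ \oo --> 0 ->
  limf_einf g F = limn_einf (EFin \o q).
Proof.
move=> gq nuoo sigmaF nuK eps0; rewrite /limf_einf /limn_einf; congr (- _)%E.
apply: (limf_esup_eq_limn_esup (q := fun n => - q n)) nuoo sigmaF nuK eps0.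
apply: filterS gq => x /andP[qg gq]; rewrite -opprD EFinN leeN2 gq/=.
by rewrite addrC -opprB EFinN leeN2.
Qed.

End limsup.

(** * Dyadic scales and the densities of J *)

Section dyadic.
Context {R : realType} (J : set nat).

Definition dens (n : nat) : R := (Jcard J n.+1)%:R / n%:R.

Lemma upper_densityE : upper_density J = limn_esup (EFin \o dens).
Proof.
congr limn_esup; apply/funext => n.
by rewrite /density_seq counting_trunc -EFinM.
Qed.

Lemma lower_densityE : lower_density J = limn_einf (EFin \o dens).
Proof.
congr limn_einf; apply/funext => n.
by rewrite /density_seq counting_trunc -EFinM.
Qed.

Definition dlog (r : R) : nat := trunc_log 2 (Num.trunc r).

Lemma dlog_bounds (r : R) : 1 <= r -> 2 ^+ dlog r <= r < 2 ^+ (dlog r).+1.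
Proof.
move=> r1; have r0 : 0 <= r by apply: le_trans r1.
have := @trunc_log_bounds 2 (Num.trunc r) isT; rewrite truncn_gt0 => /(_ r1).
rewrite /= -/(dlog r) => /andP[lo hi]; rewrite -!natrX; apply/andP; split.
  by rewrite -truncn_ge_nat.
by rewrite -truncn_lt_nat.
Qed.

Lemma dlog_exp (k : nat) : dlog (2 ^+ k) = k.
Proof.
by rewrite /dlog -natrX (@truncn_def _ _ (2 ^ k)) ?lexx ?ltr_nat//= trunc_expnK.
Qed.

Lemma dlog_ge (r : R) n : 2 ^+ n <= r -> (n <= dlog r)%N.
Proof.
move=> nr; rewrite leqNgt; apply/negP => rn.
have r1 : 1 <= r by apply: le_trans nr; rewrite exprn_ege1// ler1n.
have /andP[_] := dlog_bounds r1; apply/negP; rewrite -leNgt.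
by apply: le_trans nr; rewrite ler_weXn2l// ler1n.
Qed.

Lemma ln2_gt0 : 0 < ln 2 :> R.
Proof. by rewrite ln_gt0// ltr1n. Qed.

(** The error 5 is 3 + 1 + 1: the uncertainty on X, the gap between [Jcard J n] and [Jcard J n.+1],
    and the replacement of [ln r / ln 2], which lies in [n, n + 1], by n. The last costs at most 1
    because [Jcard J n <= n]. *)
Lemma dyadic_quotient (r X : R) : 2 <= r ->
  ((Jcard J (dlog r))%:R - 3) * ln 2 <= X <= ((Jcard J (dlog r))%:R + 3) * ln 2 ->
  dens (dlog r) - 5 / (dlog r)%:R <= X / ln r <= dens (dlog r) + 5 / (dlog r)%:R.
Proof.
move=> r2; set n := dlog r; have n1 : (1 <= n)%N by apply: dlog_ge; rewrite expr1.
have r1 : 1 <= r by lra.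
have /andP[nr rn] := dlog_bounds r1.
have r0 : 0 < r by lra.
have l2 := ln2_gt0.
pose p := ln r / ln 2.
have np : n%:R <= p.
  rewrite /p ler_pdivlMr// mulr_natl -lnXn// ler_ln// ?posrE//; by rewrite exprn_gt0.
have pn : p <= n%:R + 1.
  rewrite /p ler_pdivrMr// natr1 mulr_natl -lnXn//.
  by rewrite ler_ln// ?posrE// ?exprn_gt0// ltW.
have n0 : 1 <= n%:R :> R by rewrite ler1n.
have p0 : 0 < p by lra.
have -> : X / ln r = X / ln 2 / p.
  have lr : 0 < ln r by rewrite ln_gt0//; lra.
  by rewrite /p; field; rewrite !gt_eqF.
move=> /andP[]; rewrite -ler_pdivlMr// => A1; rewrite -ler_pdivrMr// => A2.
move: A1 A2; set A := X / ln 2 => A1 A2.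
have /andP[] := JcardS J n; rewrite /dens -(ler_nat R) -(ler_nat R) -[_.+1%:R]natr1.
have : (Jcard J n)%:R <= n%:R :> R by rewrite ler_nat Jcard_le.
have : 0 <= (Jcard J n)%:R :> R by rewrite ler0n.
move: n%:R (Jcard J n)%:R (Jcard J n.+1)%:R n0 np pn A1 A2 => m a b m1 mp pm A1 A2 a0 am ab ba.
have m0 : 0 < m by lra.
apply/andP; split.
  rewrite -mulrBl ler_pdivrMr// mulrAC ler_pdivlMr//.
  nra.
rewrite -mulrDl ler_pdivrMr// mulrAC ler_pdivlMr//.
nra.
Qed.

(** Bounded factors disappear after division by ln r. The slack 3 ln 2 comes from bounding 3 by 2^2
    and from losing one dyadic scale. *)
Lemma dyadic_limits (T : choiceType) (X : filteredType T) (F : set_system X)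
    {FF : Filter F} (g : X -> \bar R) (rad : X -> R) (sigma : nat -> X) :
  (forall x, 2 <= rad x -> exists2 Y : R, g x = (Y / ln (rad x))%:E &
    ((Jcard J (dlog (rad x)))%:R - 3) * ln 2 <= Y <= ((Jcard J (dlog (rad x)))%:R + 3) * ln 2) ->
  (forall M, \forall x \near F, M <= rad x) ->
  (forall V, F V -> \forall k \near \oo, V (sigma k)) ->
  (forall k, rad (sigma k) = 2 ^+ k) ->
  limf_esup g F = upper_density J /\ limf_einf g F = lower_density J.
Proof.
move=> gY radoo sigmaF rads; rewrite upper_densityE lower_densityE.
pose eps (n : nat) : R := 5 / n%:R.
have H1 : \forall x \near F, ((dens (dlog (rad x)) - eps (dlog (rad x)))%:E <= g x <=
    (dens (dlog (rad x)) + eps (dlog (rad x)))%:E)%E.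
  apply: filterS (radoo 2) => x x2; have [Y -> Yb] := gY x x2.
  by rewrite !lee_fin; exact: dyadic_quotient.
have H2 n : \forall x \near F, (n <= dlog (rad x))%N.
  by apply: filterS (radoo (2 ^+ n)) => x; exact: dlog_ge.
have H4 k : dlog (rad (sigma k)) = k by rewrite rads dlog_exp.
have H5 : eps @ \oo --> 0.
  rewrite -(mulr0 5); apply: cvgMr; apply/cvgrPdist_lt => e e0.
  near=> n; rewrite sub0r normrN ger0_norm// invf_plt ?posrE//; last first.
    by rewrite ltr0n; near: n; exact: nbhs_infty_gt.
  by near: n; exact: nbhs_infty_gtr.
split; first exact: limf_esup_eq_limn_esup H1 H2 sigmaF H4 H5.
exact: limf_einf_eq_limn_einf H1 H2 sigmaF H4 H5.
Unshelve. all: by end_near. Qed.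

End dyadic.

Section nonmeasurable_scaling.
Import HBNNSimple.

(** A simple function below k f, divided by k, is a simple function below f. *)
Lemma ge0_integralZl_le_nonmeasurable d (T : measurableType d) (R : realType)
    (mu : {measure set T -> \bar R}) (f : T -> \bar R) (k : R) :
  0 < k -> (forall x, 0 <= f x)%E ->
  (\int[mu]_x (k%:E * f x) <= k%:E * \int[mu]_x f x)%E.
Proof.
move=> k0 f0; have kf0 x : (0 <= k%:E * f x)%E by rewrite mule_ge0// lee_fin ltW.
rewrite [leLHS]ge0_integralTE//; apply: ge_ereal_sup => _ [h hf <-].
have mh : measurable_fun setT (EFin \o h) by exact/measurable_EFinP.
have kh x : (0 <= (k^-1 * h x)%:E :> \bar R)%E by rewrite lee_fin mulr_ge0// invr_ge0 ltW.
have -> : sintegral mu h = (k%:E * \int[mu]_x (k^-1 * h x)%:E)%E.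
  rewrite -ge0_integralZl//; last 2 first.
  - by apply/measurable_EFinP; exact: measurable_funM.
  - by rewrite lee_fin ltW.
  rewrite -[X in sintegral _ X](patch_setT (fun=> 0)) -integral_nnsfun//; apply: eq_integral => x _.
  by rewrite -EFinM mulrA divff ?gt_eqF// mul1r.
apply: lee_wpmul2l; first by rewrite lee_fin ltW.
apply: ge0_le_integral_nonmeasurable => // x.
by rewrite EFinM lee_pdivrMl.
Qed.

End nonmeasurable_scaling.

(** * The number of points in balls around the origin *)

Section balls.
Context {R : realType} (J : set nat).

Definition int_ball (e : nat -> bool) (r : R) : set int :=
  [set z | Psi_int J e z /\ `|z|%:~R <= r].

Lemma counting_nball e (r : R) : r != 0 ->
  counting (nball (Psi_set R J e) r 0) = counting (int_ball e r) :> \bar R.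
Proof.
move=> r0; rewrite /nball (negbTE r0).
rewrite -(@counting_image_inj _ _ _ (fun z => z%:~R : R)); last first.
  by move=> ? ? _ _; exact: intr_inj.
congr counting; apply/seteqP; split => x /=.
  by move=> [[z Pz <-]]; rewrite subr0 -intr_norm => zr; exists z.
by move=> [z [Pz zr] <-]; split; [exists z|rewrite subr0 -intr_norm].
Qed.

Lemma counting_int_ball_le e n (r : R) : r < 2 ^+ n.+1 ->
  (counting (int_ball e r) <= (3 * 2 ^+ Jcard J n)%:E :> \bar R)%E.
Proof.
move=> rn; have [A cA AP] := Psi_int_card J e n.
apply: (@le_trans _ _ (counting [set` A])).
  apply: counting_le => z [Pz zr] /=; apply: AP => //.
  by rewrite -(ltr_int R) rmorphXn /=; exact: le_lt_trans rn.
by rewrite counting_fset lee_fin -natrX -natrM ler_nat.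
Qed.

(** The sums over the subsets of [trunc J m] are distinct and have absolute value at most 2^(m+1) -
    2. *)
Lemma counting_int_ball_ge e m (r : R) : 2 ^+ m.+1 <= r ->
  ((2 ^+ Jcard J m)%:E <= counting (int_ball e r) :> \bar R)%E.
Proof.
move=> mr; rewrite -natrX -card_fpowerset -counting_fset.
rewrite -(@counting_image_inj _ _ _ (psum e)); last by move=> ? ? _ _; exact: psum_inj.
apply: counting_le => _ [F /= + <-]; rewrite fpowersetE => /subset_truncP[FJ Fm].
split; first by rewrite Psi_intE; exists F.
apply: le_trans mr; apply: (@le_trans _ _ ((2 ^+ m.+1 - 2)%:~R)).
  by rewrite ler_int psum_le.
by rewrite intrB rmorphXn /= lerBlDr lerDl.
Qed.

End balls.

(** * Lower bounds by mass transport *)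

Section coverings.
Context {R : realType} {d : measure_display} {Omega : measurableType d}.
Variables (P : probability Omega R) (J : set nat) (s : nat -> Omega -> bool).
Hypothesis hs : iid_fair_signs P J s.

Let Psi w := Psi_set R J (s^~ w).

Lemma Psi0 w : pts (Psi w) 0.
Proof. by have := @pts_Psi R J (s^~ w) 0; rewrite mulr0z => ->; exact: Psi_int0. Qed.

Lemma point_mark_pts d' (Xi : measurableType d') (phi : lfset R) (m : marking Xi phi) x rho :
  point_mark m x = Some rho -> pts phi x.
Proof. by rewrite /point_mark; case: pselect. Qed.

(** Each point sends unit mass to every selected point within distance r, and a selected point
    receives at most K, the bound for the points in its ball. Hence K times the intensity is at
    least 1. *)
Lemma lambda_ge n (r : R) : 1 <= r -> r < 2 ^+ n.+1 ->
  (((3 * 2 ^+ Jcard J n)^-1)%:E <= lambda P Psi r)%E.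
Proof.
move=> r1 rn; set K := 3 * 2 ^+ _.
have K0 : 0 < K by rewrite mulr_gt0// exprn_gt0.
have r0 : r != 0 by rewrite gt_eqF//; lra.
apply: le_ereal_inf_tmp => _ [S covS <-].
pose D (z : int) : set bool := [set b | b /\ `|z|%:~R <= r].
have := @covering_lower_bound R d Omega P J s hs _ bool S D (fun b => if b then K else 0).
have H1 z : measurable (D z) by [].
have H2 b : 0 <= (if b then K else 0) by case: b => //; exact: ltW.
have H3 (e : nat -> bool) (b : bool) : (counting [set z | Psi_int J e z /\ D (- z)%R b]
    <= ((if b then K else 0))%:E)%E.
  case: b.
    apply: le_trans (counting_int_ball_le J e rn); apply: counting_le => z [Pz [_]].
    by rewrite normrN.
  rewrite (_ : [set z | _] = set0); first by rewrite /counting asboolT// fset_set0.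
  by apply/seteqP; split => // z [_ []].
have H4 : {ae P, forall w, {ae S (Psi w), forall m, exists2 z : int,
    Psi_int J (s^~ w) z & mark_event z%:~R (D z) (phi := Psi w) m}}.
  apply: filterS covS => w; apply: filterS => m /(_ 0 (Psi0 w))[v mv].
  rewrite /nball (negbTE r0) /= sub0r normrN => -[_ vr].
  have [z Pz zv] := point_mark_pts mv.
  rewrite -zv in mv vr; exists z => //; exists true => //; split => //.
  by rewrite intr_norm.
move=> /(_ H1 H2 H3 H4) le1.
rewrite -[leLHS]mule1 lee_pdivrMl//.
apply: (le_trans le1); rewrite le_eqVlt; apply/predU1P; left.
transitivity (\int[P]_w (K%:E * S (Psi w) (mark_event 0 [set true] (phi := Psi w))))%E.
  apply: eq_integral => w _.
  transitivity (\int[S (Psi w)]_m (K%:E * (\1_(mark_event 0 [set true] (phi := Psi w)) m)%:E))%E.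
    apply: eq_integral => m _; rewrite (point_markE m (Psi0 w)) /= indicE.
    rewrite (mark_eventE _ (Psi0 w)).
    case: (boolP (m \in _)); first by rewrite inE /= => ->; rewrite mule1.
    by rewrite notin_setE /=; case: (m _ _) => // _; rewrite mule0.
  rewrite ge0_integralZl//; last 2 first.
  - apply/measurable_EFinP/measurable_indic; exact: measurable_mark_event.
  - exact: ltW.
  by rewrite integral_indic ?setIT//; exact: measurable_mark_event.
rewrite ge0_integralZl//; last 2 first.
- exact: (measurable_eproc_mark_Psi hs).
- exact: ltW.
congr (_ * _)%E; apply: eq_integral => w _; congr (S (Psi w) _).
by apply/seteqP; split => m /=; [case=> b pb bt; rewrite pb bt|exists true].
Qed.

(** This is the mass distribution principle: the hypothesis bounds the number of points in a ball of
    radius rho by K rho^alpha, so that K R(0)^alpha dominates the mass received by 0. *)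
Lemma Hcontent1_ge (alpha K : R) : 0 < K ->
  (forall (n : nat) (rho : R), 2 ^+ n <= rho -> rho < 2 ^+ n.+1 ->
    3 * 2 ^+ Jcard J n <= K * rho `^ alpha) ->
  ((K^-1)%:E <= Hcontent1 P Psi alpha)%E.
Proof.
move=> K0 HK; apply: le_ereal_inf_tmp => _ [S covS <-].
(* Radius 0 is excluded because its ball is empty, not reduced to the centre. *)
pose D (z : int) : set (Defs.radius R) := [set rho | sval rho != 0 /\ `|z|%:~R <= sval rho].
have gauge_ge0 rho : 0 <= gauge alpha rho by rewrite /gauge; case: ifP => // _; exact: powR_ge0.
have := @covering_lower_bound R d Omega P J s hs _ (Defs.radius R) S D
  (fun rho => K * gauge alpha rho).
have H1 z : measurable (D z).
  exists [set x | x != 0 /\ `|z|%:~R <= x].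
    rewrite (_ : [set x | _] = ~` [set 0] `&` `[`|z|%:~R, +oo[).
      by apply: measurableI; [apply: measurableC; exact: measurable_set1|exact: measurable_itv].
    by apply/seteqP; split => x /=; rewrite in_itv/= andbT => -[/eqP].
  by rewrite setTI.
have H2 rho : 0 <= K * gauge alpha rho by rewrite mulr_ge0// ltW.
have H3 (e : nat -> bool) (rho : Defs.radius R) : (counting [set z | Psi_int J e z /\ D (- z)%R rho]
    <= (K * gauge alpha rho)%:E)%E.
  have [rho0|rho0] := eqVneq (sval rho) 0.
    rewrite (_ : [set z | _] = set0); first by rewrite /counting asboolT// fset_set0 lee_fin.
    by apply/seteqP; split => // z [_ []]; rewrite rho0 eqxx.
  have rho1 : 1 <= sval rho by have := svalP rho; rewrite (negbTE rho0).
  have /andP[lo hi] := dlog_bounds rho1.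
  rewrite /gauge (negbTE rho0).
  apply: (@le_trans _ _ (3 * 2 ^+ Jcard J (dlog (sval rho)))%:E); last first.
    by rewrite lee_fin; exact: HK.
  apply: le_trans (counting_int_ball_le J e hi); apply: counting_le => z [Pz [_]].
  by rewrite normrN.
have H4 : {ae P, forall w, {ae S (Psi w), forall m, exists2 z : int,
    Psi_int J (s^~ w) z & mark_event z%:~R (D z) (phi := Psi w) m}}.
  apply: filterS covS => w; apply: filterS => m /(_ 0 (Psi0 w))[v [rho mv]].
  rewrite /nball; case: ifPn => //= rho0; rewrite sub0r normrN => -[_ vr].
  have [z Pz zv] := point_mark_pts mv.
  rewrite -zv in mv vr; exists z => //; exists rho => //; split => //.
  by rewrite intr_norm.
move=> /(_ H1 H2 H3 H4) le1.
rewrite -[leLHS]mule1 lee_pdivrMl//; apply: (le_trans le1).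
apply: (@le_trans _ _ (\int[P]_w (K%:E *
    \int[S (Psi w)]_m (oapp (gauge alpha) 0%R (point_mark m 0%R))%:E))%E).
  have oapp_ge0 (G : Defs.radius R -> R) x : (forall rho, 0 <= G rho) -> 0 <= oapp G 0 x.
    by case: x => /=.
  apply: ge0_le_integral_nonmeasurable => w.
    by apply: integral_ge0 => m _; rewrite lee_fin oapp_ge0.
  apply: le_trans (ge0_integralZl_le_nonmeasurable _ _ _) => //; last first.
    by move=> m; rewrite lee_fin oapp_ge0.
  rewrite le_eqVlt; apply/predU1P; left; apply: eq_integral => m _.
  by case: (point_mark m 0) => [rho|] /=; rewrite -EFinM ?mulr0.
apply: ge0_integralZl_le_nonmeasurable => // w.
by apply: integral_ge0 => m _; rewrite lee_fin; case: (point_mark m 0) => /=.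
Qed.

End coverings.

Lemma measurable_gauge (R : realType) (alpha : R) :
  measurable_fun [set: Defs.radius R] (gauge alpha).
Proof.
have mval : measurable_fun [set: Defs.radius R] (fun rho => sval rho : R).
  by move=> _ B mB; exists B.
have mpow : measurable_fun [set: R] (fun x => (\1_(~` [set 0]) x * x `^ alpha : R)).
  apply: measurable_funM; last exact: measurable_powR.
  by apply: measurable_indic; apply: measurableC; exact: measurable_set1.
rewrite (_ : gauge alpha = (fun x => \1_(~` [set 0]) x * x `^ alpha) \o (fun rho => sval rho)).
  exact: (measurableT_comp mpow mval).
apply/funext => rho; rewrite /gauge /= indicE.
have [->|rho0] := eqVneq (sval rho) 0; first by rewrite memNset ?mul0r//= => /(_ erefl).
by rewrite mem_set ?mul1r//=; exact/eqP.
Qed.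

(** * Upper bounds by the grid *)

Section upper_bounds.
Context {R : realType} {d : measure_display} {Omega : measurableType d}.
Variables (P : probability Omega R) (J : set nat) (s : nat -> Omega -> bool).
Hypothesis hs : iid_fair_signs P J s.

Let Psi w := Psi_set R J (s^~ w).

(** Every offset gives a covering. The almost sure statement also asks for a measurable event,
    obtained by letting points and centres range over the enumerated integers. *)
Lemma grid_covers (L : R) (L0 : 0 < L) d' (Xi : measurableType d') (xi0 xi1 : Xi)
    (C : set Xi) (e : nat -> bool) : measurable C -> C xi1 ->
  {ae grid_law L0 xi0 xi1 (Psi_set R J e), forall m, forall x,
    pts (Psi_set R J e) x -> exists2 v,
      mark_event v C (phi := Psi_set R J e) m & `|x - v| <= L}.
Proof.
move=> mC C1; pose phi := Psi_set R J e.
pose near n := [set k | Psi_int J e (zenum k) /\ `|(zenum n)%:~R - (zenum k)%:~R| <= L].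
pose G := \bigcap_(n in [set n | Psi_int J e (zenum n)])
  \bigcup_(k in near n) mark_event (zenum k)%:~R C (phi := phi).
have mG : measurable G.
  apply: bigcap_measurableType => n _; apply: bigcup_measurable => k _.
  exact: measurable_mark_event.
exists (~` G); split; first exact: measurableC.
  rewrite grid_lawE (_ : [set u | _] = set0) ?measure0//.
  apply/seteqP; split => // u; apply => n Pn.
  have /(@leader_exists R L L0 phi u)[v [pv lv xv]] : pts phi (zenum n)%:~R by exact/pts_Psi.
  move: (pv) => [z Pz zv]; have [k kz] := zenum_surj z.
  exists k; first by split; rewrite kz// zv ltW.
  rewrite kz zv (mark_eventE C pv) /= /grid_marking /grid_mark /=.
  by rewrite asboolT.
apply: subsetC => m Gm x [z Pz <-]; have [n nz] := zenum_surj z.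
have [|k [Pk nk] mk] := Gm n; first by rewrite /= nz.
by exists (zenum k)%:~R; rewrite -?nz.
Qed.

Lemma lambda_le m (r : R) : 2 ^+ m.+1 <= r ->
  (lambda P Psi r <= (3 / 2 ^+ Jcard J m)%:E)%E.
Proof.
move=> mr; have r0 : 0 < r by apply: lt_le_trans mr; rewrite exprn_gt0.
pose S := grid_eproc r0 false true P Psi.
apply: (@le_trans _ _ (intensity S)).
  apply: ereal_inf_lbound; exists S => //.
  apply: aeW => w.
  have := @grid_covers r r0 _ bool false true [set true] (s^~ w) I erefl.
  apply: filterS => m' cov x px; have [v [b mv bt] xv] := cov x px.
  by exists v; rewrite ?mv ?bt// /nball gt_eqF.
have := @grid_intensity R r r0 _ bool false true _ _ P J s hs [set true] m I erefl.
move=> /(_ (fun H => ltac:(discriminate H)) mr); apply: le_trans.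
rewrite le_eqVlt; apply/predU1P; left; apply: eq_integral => w _.
congr (grid_law _ _ _ _ _); apply/seteqP; split => m' /=; last by case=> b pb bt; rewrite pb bt.
by exists true.
Qed.

(** Leaders of the grid of length r get radius r and the other points radius 0: the cost is r^alpha
    times the intensity of the leaders. *)
Lemma Hcontent1_le (alpha : R) m (r : R) : 0 <= alpha -> 2 ^+ m.+1 <= r ->
  (Hcontent1 P Psi alpha <= (r `^ alpha * (3 / 2 ^+ Jcard J m))%:E)%E.
Proof.
move=> a0 mr; have r0 : 0 < r by apply: lt_le_trans mr; rewrite exprn_gt0.
have r1 : 1 <= r by apply: le_trans mr; rewrite exprn_ege1// ler1n.
pose xi0 : Defs.radius R := exist _ 0 (introT orP (or_introl (eqxx 0))).
pose xi1 : Defs.radius R := exist _ r (introT orP (or_intror r1)).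
pose S := grid_eproc r0 xi0 xi1 P Psi.
pose C : set (Defs.radius R) := [set rho | sval rho = r].
have mC : measurable C by exists [set r]; [exact: measurable_set1|rewrite setTI].
have C0 : ~ C xi0 by rewrite /C /= => r0'; move: (r0); rewrite -r0' ltxx.
apply: (@le_trans _ _ (covering_cost alpha S)).
  apply: ereal_inf_lbound; exists S => //.
  apply: aeW => w; have := @grid_covers r r0 _ _ xi0 xi1 C (s^~ w) mC erefl.
  apply: filterS => m' cov x px; have [v [rho mv rhor] xv] := cov x px.
  by exists v, rho => //; rewrite rhor /nball gt_eqF.
have := @grid_intensity R r r0 _ _ xi0 xi1 _ _ P J s hs C m mC erefl C0 mr.
move=> I3; rewrite EFinM; apply: le_trans (lee_wpmul2l _ I3); last by rewrite lee_fin powR_ge0.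
have h0 w : (0 <= S (Psi w) (mark_event 0 C (phi := Psi w)))%E by exact: measure_ge0.
rewrite -ge0_integralZl//; last 2 first.
- exact: (measurable_eproc_mark_Psi hs S).
- by rewrite lee_fin powR_ge0.
rewrite /covering_cost le_eqVlt; apply/predU1P; left; apply: eq_integral => w _.
transitivity (\int[S (Psi w)]_m
  ((r `^ alpha)%:E * (\1_(mark_event 0 C (phi := Psi w)) m)%:E))%E; last first.
  rewrite ge0_integralZl//; last 2 first.
  - apply/measurable_EFinP/measurable_indic; exact: measurable_mark_event.
  - by rewrite lee_fin powR_ge0.
  by rewrite integral_indic ?setIT//; exact: measurable_mark_event.
have p0 : pts (Psi w) 0 by exact: Psi0.
have mm : measurable_fun setT
    (fun m : marking (Defs.radius R) (Psi w) =>
      m (exist _ 0 (mem_set p0)) (exist _ 0 (mem_set p0))).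
  move=> _ B mB; rewrite setTI; apply: sub_sigma_algebra.
  by exists (exist _ 0 (mem_set p0)), (exist _ 0 (mem_set p0)), B.
have E m' : oapp (gauge alpha) 0 (point_mark m' 0) =
    gauge alpha (m' (exist _ 0 (mem_set p0)) (exist _ 0 (mem_set p0))).
  by rewrite (point_markE m' p0).
under eq_integral do rewrite E.
rewrite /S /= /grid_law /push_prob ge0_integral_distribution//; last 2 first.
- by apply/measurable_EFinP; exact: (measurableT_comp (@measurable_gauge R alpha) mm).
- by move=> m'; rewrite lee_fin /gauge; case: ifP => // _; exact: powR_ge0.
rewrite ge0_integral_distribution//; last 2 first.
- apply: emeasurable_funM => //; apply/measurable_EFinP/measurable_indic.
  exact: measurable_mark_event.
- by move=> m'; rewrite mule_ge0// lee_fin// powR_ge0.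
apply: eq_integral => u _ /=; rewrite -EFinM indicE (mark_eventE C p0).
rewrite /grid_marking /grid_mark /=; case: (asboolP (leader _ _ _ _)) => lead.
  by rewrite mem_set ?mulr1 /gauge/= ?gt_eqF// /grid_marking /grid_mark/= asboolT.
(* A point of radius 0 costs nothing even when alpha = 0, by the convention on 0^0. *)
rewrite memNset ?mulr0 /gauge/= ?eqxx//= /grid_marking /grid_mark/= asboolF//.
Qed.

End upper_bounds.

(** * The dimensions *)

Section dimensions.
Context {R : realType} {d : measure_display} {Omega : measurableType d}.
Variables (P : probability Omega R) (J : set nat) (s : nat -> Omega -> bool).
Hypothesis hs : iid_fair_signs P J s.

Let Psi w := Psi_set R J (s^~ w).

Let ln3_le : ln 3 <= 2 * ln 2 :> R.
Proof.
rewrite mulr_natl -lnXn// ler_ln ?posrE ?exprn_gt0//.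
by rewrite -natrX ler_nat.
Qed.

(** T_m fits in the ball of radius r when 2^(m+1) <= r, so the index one below [dlog r] is taken; r
    >= 2 makes it a natural number. *)
Let dlog_pred (r : R) : 2 <= r -> exists m, [/\ 2 ^+ m.+1 <= r, r < 2 ^+ (dlog r).+1,
  (Jcard J (dlog r) <= (Jcard J m).+1)%N & (0 < dlog r)%N].
Proof.
move=> r2; have n1 : (0 < dlog r)%N by apply: dlog_ge; rewrite expr1.
have /andP[nr rn] : 2 ^+ dlog r <= r < 2 ^+ (dlog r).+1 by apply: dlog_bounds; lra.
exists (dlog r).-1; rewrite prednK//; split => //.
by have /andP[_] := JcardS J (dlog r).-1; rewrite prednK.
Qed.

Let pow_gt0 n : 0 < 2 ^+ n :> R.
Proof. by rewrite exprn_gt0. Qed.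

Let lnpow k : ln (2 ^+ k) = k%:R * ln 2 :> R.
Proof. by rewrite lnXn// mulr_natl. Qed.

Lemma udim_M_limits : upper_udim_M P Psi = upper_density J /\
  lower_udim_M P Psi = lower_density J.
Proof.
apply: (@dyadic_limits R J _ R^o (pinfty_nbhs R) _ _ id (fun k => 2 ^+ k)).
- move=> r r2; have [m [mr rn JS n0]] := dlog_pred r2.
  have l1 := lambda_le hs mr; have r1 : 1 <= r by lra.
  have l2 := lambda_ge hs r1 rn.
  have lfin : lambda P Psi r \is a fin_num.
    by rewrite fin_numE; apply/andP; split; [apply: contraTneq l2 => ->|apply: contraTneq l1 => ->].
  move: l1 l2; rewrite -(fineK lfin) !lee_fin; set l := fine _ => l1 l2.
  have l0 : 0 < l by apply: lt_le_trans l2; rewrite invr_gt0 mulr_gt0.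
  exists (- ln l); first by rewrite /udim_M_fun -(fineK lfin) lne_EFin// -EFinN -EFinM.
  have ln2 := @ln2_gt0 R.
  have : ln l <= ln (3 / 2 ^+ Jcard J m) by rewrite ler_ln ?posrE// divr_gt0.
  have : ln ((3 * 2 ^+ Jcard J (dlog r))^-1) <= ln l by rewrite ler_ln ?posrE// invr_gt0 mulr_gt0.
  rewrite lnV ?posrE ?mulr_gt0// ln_div ?posrE// lnM ?posrE// !lnpow.
  have {}JS : (Jcard J (dlog r))%:R * ln 2 <= ((Jcard J m)%:R + 1) * ln 2 :> R.
    by rewrite ler_pM2r// natr1 ler_nat.
  have := ln3_le; move: JS; rewrite mulrDl.
  by move=> ? ? ? ?; rewrite mulrBl mulrDl; apply/andP; split; lra.
- by move=> M; exists M; split; [exact: num_real|move=> x /ltW].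
- move=> V [M [_ MV]]; have [k Mk] : exists k : nat, M < k%:R.
    by exists (Num.bound `|M|); apply: le_lt_trans (archi_boundP (normr_ge0 M)); exact: ler_norm.
  near=> n; apply: MV; apply: (lt_le_trans Mk); rewrite -natrX ler_nat.
  apply: (@leq_trans n); last exact/ltnW/ltn_expl.
  by near: n; exact: nbhs_infty_ge.
- by [].
Unshelve. all: by end_near. Qed.

Lemma growth_limits (e : nat -> bool) :
  let f n := counting (nball (Psi_set R J e) n%:R 0) : \bar R in
  upper_growth f = upper_density J /\ lower_growth f = lower_density J.
Proof.
move=> f; apply: (@dyadic_limits R J _ nat \oo _ _ (fun n => n%:R) (fun k => 2 ^ k)%N).
- move=> n r2; have [m [mr rn JS n0]] := dlog_pred r2.
  have c1 := counting_int_ball_ge J e mr; have c2 := counting_int_ball_le J e rn.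
  have cE : f n = counting (int_ball J e (n%:R : R)).
    by rewrite /f counting_nball// gt_eqF//; lra.
  rewrite -cE in c1 c2.
  have ffin : f n \is a fin_num.
    by rewrite fin_numE; apply/andP; split; [apply: contraTneq c1 => ->|apply: contraTneq c2 => ->].
  move: c1 c2; rewrite -(fineK ffin) !lee_fin; set c := fine _ => c1 c2.
  have c0 : 0 < c by apply: lt_le_trans c1.
  exists (ln c); first by rewrite /growth_seq -(fineK ffin) lne_EFin// -EFinM.
  have ln2 := @ln2_gt0 R.
  have : ln c <= ln (3 * 2 ^+ Jcard J (dlog (n%:R : R))) by rewrite ler_ln ?posrE// mulr_gt0.
  have : ln (2 ^+ Jcard J m) <= ln c by rewrite ler_ln ?posrE.
  rewrite lnM ?posrE// !lnpow.
  have {}JS : (Jcard J (dlog (n%:R : R)))%:R * ln 2 <= ((Jcard J m)%:R + 1) * ln 2 :> R.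
    by rewrite ler_pM2r// natr1 ler_nat.
  have := ln3_le; move: JS; rewrite mulrDl.
  by move=> ? ? ? ?; rewrite mulrBl mulrDl; apply/andP; split; lra.
- move=> M; near=> n; apply: ltW; near: n; exact: nbhs_infty_gtr.
- move=> V [N _ NV]; exists N => // k /= Nk; apply: NV => /=.
  by apply: (leq_trans Nk); exact/ltnW/ltn_expl.
- by move=> k; rewrite natrX.
Unshelve. all: by end_near. Qed.

Lemma upper_density_ge0 : (0 <= upper_density J :> \bar R)%E.
Proof.
apply: limf_esup_ge0 => [|n]; first by apply: filter_not_empty.
by rewrite /density_seq counting_trunc -EFinM lee_fin divr_ge0.
Qed.

(** Beyond some index N, [dens J n < alpha] gives 2^(Jcard J n) <= (2^n)^alpha <= rho^alpha. The
    scales n <= N are absorbed in K, since there 2^(Jcard J n) <= 2^N and rho >= 1. *)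
Lemma Hcontent1_gt0 (alpha : R) : (upper_density J < alpha%:E)%E ->
  (0 < Hcontent1 P Psi alpha)%E.
Proof.
move=> da; have a0 : 0 < alpha.
  by rewrite -lte_fin; apply: le_lt_trans da; exact: upper_density_ge0.
move: da; rewrite upper_densityE => /near_limf_esup_lt[N _ HN].
pose K : R := 3 * 2 ^+ N.
have K0 : 0 < K by rewrite mulr_gt0.
apply: (@lt_le_trans _ _ (K^-1)%:E); first by rewrite lte_fin invr_gt0.
apply: (Hcontent1_ge hs K0) => n rho nrho _.
rewrite /K -mulrA; apply: ler_wpM2l => //.
have rho1 : 1 <= rho by apply: le_trans nrho; rewrite exprn_ege1// ler1n.
have [Nn|nN] := leqP N.+1 n; last first.
  apply: (@le_trans _ _ (2 ^+ N)).
    by rewrite ler_weXn2l ?ler1n// (leq_trans (Jcard_le J n))// -ltnS.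
  rewrite ler_peMr ?exprn_ge0// -(powRr0 rho) ler_powR// ltW//.
have {}HN : dens J n < alpha :> R by rewrite -lte_fin; apply: HN => /=; exact: ltnW.
have n0 : 0 < n%:R :> R by rewrite ltr0n; exact: leq_ltn_trans Nn.
apply: (@le_trans _ _ (rho `^ alpha)); last first.
  by rewrite ler_peMl ?powR_ge0// exprn_ege1// ler1n.
apply: (@le_trans _ _ ((2 ^+ n) `^ alpha)); last first.
  by apply: ge0_ler_powR; rewrite ?nnegrE ?exprn_ge0// ?(le_trans _ rho1)// ltW.
rewrite -!powR_mulrn// -powRrM; apply: ler_powR; first by rewrite ler1n.
move: HN; rewrite /dens ltr_pdivrMr// => /ltW; rewrite mulrC; apply: le_trans.
by rewrite ler_nat; case/andP: (JcardS J n).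
Qed.

(** For c strictly between alpha and the upper density, [dens J n > c] holds for infinitely many n,
    and the grid of length 2^(n+2) then costs at most K 2^(-(c - alpha) n), which is arbitrarily
    small. *)
Lemma Hcontent1_eq0 (alpha : R) : 0 <= alpha -> (alpha%:E < upper_density J)%E ->
  Hcontent1 P Psi alpha = 0%E.
Proof.
move=> a0 /lt_ereal_dense[c /andP[]]; rewrite lte_fin => ac cd.
apply/eqP; rewrite eq_le; apply/andP; split; last first.
  apply: le_ereal_inf_tmp => _ [S _ <-]; apply: integral_ge0 => w _.
  apply: integral_ge0 => m _; rewrite lee_fin; case: (point_mark m 0) => //= rho.
  by rewrite /gauge; case: ifP => // _; exact: powR_ge0.
rewrite leNgt; apply/negP => /lt_ereal_dense[e /andP[]]; rewrite lte_fin => e0.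
apply/negP; rewrite -leNgt.
pose K : R := 3 * 2 `^ (2 * alpha).
have ln2 := @ln2_gt0 R.
have del0 : 0 < e * (c - alpha) * ln 2 by rewrite !mulr_gt0// subr_gt0.
have K0 : 0 < K by rewrite mulr_gt0// powR_gt0.
(* For n > N this gives K <= e (c - alpha) (ln 2) n, and 2^x >= 1 + x ln 2 then yields K <= e 2^((c
   - alpha) n). *)
pose N := Num.bound (K / (e * (c - alpha) * ln 2)).
have [n [Nn cn]] : exists n, (N < n)%N /\ c < dens J n.
  apply: contrapT => H; move: cd; apply/negP; rewrite -leNgt upper_densityE.
  apply: limf_esup_le_near; exists N.+1 => // n /= Nn.
  by rewrite lee_fin leNgt; apply/negP => cn; apply: H; exists n.
have n0 : 0 < n%:R :> R by rewrite ltr0n; exact: leq_ltn_trans Nn.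
have KN : K <= e * (c - alpha) * ln 2 * n%:R.
  rewrite mulrC -ler_pdivrMr//; apply: (@le_trans _ _ N%:R); last by rewrite ler_nat ltnW.
  by apply/ltW/archi_boundP; rewrite divr_ge0 ?ltW.
move: cn; rewrite /dens ltr_pdivlMr// => cn.
(* Taking m = n + 1 produces the exponent [Jcard J n.+1], the numerator of [dens J n]. *)
apply: (le_trans (@Hcontent1_le _ _ _ P J s hs alpha n.+1 (2 ^+ n.+2) a0 (lexx _))).
rewrite lee_fin mulrCA mulrA ler_pdivrMr//.
rewrite -!powR_mulrn// -powRrM.
have -> : n.+2%:R * alpha = 2 * alpha + alpha * n%:R by rewrite -addn2 natrD; ring.
rewrite powRD; last by rewrite pnatr_eq0 implybT.
apply: (@le_trans _ _ (K * 2 `^ (alpha * n%:R))); first by rewrite /K mulrA.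
apply: (@le_trans _ _ (e * 2 `^ (c * n%:R))); last first.
  by apply: ler_wpM2l; [exact: ltW|apply: ler_powR; rewrite ?ler1n// ltW].
have -> : c * n%:R = (c - alpha) * n%:R + alpha * n%:R by ring.
rewrite powRD; last by rewrite pnatr_eq0 implybT.
rewrite mulrA; apply: ler_wpM2r; first exact: powR_ge0.
apply: (le_trans KN); rewrite -!mulrA; apply: ler_wpM2l; first exact: ltW.
rewrite /powR pnatr_eq0 /=.
apply: le_trans (expR_ge1Dx _).
by rewrite [ln 2 * _]mulrC mulrA lerDr.
Qed.

(** The content vanishes below the upper density and is positive above it, which settles the
    supremum whatever happens at the critical exponent; the maximum with 0 takes care of density
    0. *)
Lemma udim_H_upper_density : udim_H P Psi = upper_density J.
Proof.
apply/eqP; rewrite eq_le; apply/andP; split.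
  rewrite ge_max upper_density_ge0; apply: ge_ereal_sup => _ [alpha [a0 H0] <-].
  by rewrite leNgt; apply/negP => /Hcontent1_gt0; rewrite H0 ltxx.
rewrite leNgt; apply/negP => /lt_ereal_dense[c /andP[]].
rewrite gt_max lte_fin => /andP[c0 supc] cd; move: supc; apply/negP; rewrite -leNgt.
apply: ereal_sup_ubound; exists c => //; split; first exact: ltW.
by apply: Hcontent1_eq0 => //; exact: ltW.
Qed.

End dimensions.

Theorem proposition6p11 (R : realType) (d : measure_display)
    (Omega : measurableType d) (P : probability Omega R)
    (J : set nat) (s : nat -> Omega -> bool) (hs : iid_fair_signs P J s)
    (Psi : Omega -> lfset R) (hPsi : forall w, Psi w = Psi_set R J (s^~ w)) :
  {ae P, forall w,
    [/\ udim_H P Psi = upper_udim_M P Psi,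
        upper_udim_M P Psi =
          upper_growth (fun n => counting (R := R) (nball (Psi w) n%:R 0)) &
        upper_growth (fun n => counting (R := R) (nball (Psi w) n%:R 0)) =
          upper_density J] /\
    lower_udim_M P Psi =
      lower_growth (fun n => counting (R := R) (nball (Psi w) n%:R 0)) /\
    lower_growth (fun n => counting (R := R) (nball (Psi w) n%:R 0)) =
      lower_density J}.
Proof.
have {hPsi}-> : Psi = fun w => Psi_set R J (s^~ w) by exact/funext.
(* The dimensions do not depend on w and the growth rates are known for every sign sequence, so the
   equalities hold for all w. *)
apply: aeW => w; have [uM lM] := udim_M_limits hs.
have [ug lg] := @growth_limits R J (s^~ w).
by rewrite (udim_H_upper_density hs) uM lM ug lg.
Qed.
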